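(* Let $E\subset M$ be measurable, $x\in M$, and let $(U,\varphi)$ be a normal chart centered in $x$. Then the density of $E$ at $x$ coincides with the density of its image under $\varphi$, that is, $$\Theta_E(x)=\Theta_{\varphi(E)}(\varphi(x)),$$ where the left-hand density is taken in $(M,g)$ and the right-hand one in Euclidean $\mathbb R^m$.
   Context: $M=(M,g)$ is a smooth, connected, oriented $m$-dimensional Riemannian manifold with volume measure $\mathrm{vol}$ and Riemannian balls $B(x,r)$; chart domains are relatively compact. For measurable $E\subset M$, $\Theta_E(x,r)=\mathrm{vol}(E\cap B(x,r))/\mathrm{vol}(B(x,r))$ and the density of $E$ at $x$ is $\Theta_E(x)=\lim_{r\downarrow0}\Theta_E(x,r)$; in $\mathbb R^m$ the density is defined in the same way with Lebesgue measure and Euclidean balls. For a chart, $\varphi(E):=\varphi(E\cap U)$. A normal chart centered in $x$ is a chart induced by $\exp_x^{-1}$ (with $T_xM$ identified with $\mathbb R^m$ via a $g_x$-orthonormal basis). *)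

(* Defs.v *)
From HB Require Import structures.
From mathcomp Require Import all_boot all_order all_algebra.
From mathcomp Require Import all_classical all_reals all_analysis.

Set Implicit Arguments.
Unset Strict Implicit.
Unset Printing Implicit Defensive.

Import Order.TTheory GRing.Theory Num.Theory.
Import numFieldNormedType.Exports.

Local Open Scope classical_set_scope.
Local Open Scope ring_scope.

(** * Lebesgue measure on R^m *)

Section lebesgue_rV.
Context (R : realType) (m : nat).
Implicit Types (Q : 'rV[R]_m * 'rV[R]_m) (C : set ('rV[R]_m * 'rV[R]_m)).

Definition box Q : set 'rV[R]_m :=
  [set y | forall i, Q.1 ord0 i < y ord0 i <= Q.2 ord0 i].

Definition box_vol Q : \bar R :=
  (\prod_i Num.max 0 (Q.2 ord0 i - Q.1 ord0 i))%:E.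

(* Countable families of boxes are sets of boxes rather than sequences: when
   m = 0 there is no box of volume 0 with which to pad a finite cover. *)
Definition box_cover (A : set 'rV[R]_m) : set (set ('rV[R]_m * 'rV[R]_m)) :=
  [set C | countable C /\ A `<=` \bigcup_(Q in C) box Q].

Definition lebesgue_rV (A : set 'rV[R]_m) : \bar R :=
  ereal_inf [set \esum_(Q in C) box_vol Q | C in box_cover A].

Lemma box_vol_ge0 Q : (0 <= box_vol Q)%E.
Proof. by rewrite lee_fin prodr_ge0// => i _; rewrite le_max lexx. Qed.

Lemma lebesgue_rV_ge0 A : (0 <= lebesgue_rV A)%E.
Proof.
apply: le_ereal_inf_tmp => _ [C _ <-].
by apply: esum_ge0 => Q _; exact: box_vol_ge0.
Qed.

Lemma lebesgue_rV0 : lebesgue_rV set0 = 0%E.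
Proof.
apply/eqP; rewrite eq_le lebesgue_rV_ge0 andbT; apply: ereal_inf_lbound.
by exists set0; [split => //; exact: countable0|exact: esum_set0].
Qed.

Lemma le_lebesgue_rV : {homo lebesgue_rV : A B / A `<=` B >-> (A <= B)%E}.
Proof.
move=> A B AB; apply: ereal_inf_le_tmp => _ [C [cC BC] <-].
by exists C => //; split => //; exact: subset_trans BC.
Qed.

Lemma lebesgue_rV_sigma_subadditive : sigma_subadditive lebesgue_rV.
Proof.
move=> A; have [[i ioo]|] := pselect (exists i, lebesgue_rV (A i) = +oo%E).
  rewrite (eseries_pinfty _ _ ioo) ?leey// => n _.
  by rewrite -ltNye (lt_le_trans _ (lebesgue_rV_ge0 _)).
rewrite -forallNE => Aoo.
apply/lee_addgt0Pr => _/posnumP[e].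
rewrite (le_trans _ (epsilon_trick _ _ _))//; last first.
  by move=> n; exact: lebesgue_rV_ge0.
have [C PC] : {C : nat -> set ('rV[R]_m * 'rV[R]_m) &
    forall n, box_cover (A n) (C n) /\
      (\esum_(Q in C n) box_vol Q <=
       lebesgue_rV (A n) + (e%:num / (2 ^ n.+1)%:R)%:E)%E}.
  apply: (@choice _ _ (fun n C => box_cover (A n) C /\
      (\esum_(Q in C) box_vol Q <=
       lebesgue_rV (A n) + (e%:num / (2 ^ n.+1)%:R)%:E)%E)) => n.
  have en : 0 < e%:num / (2 ^ n.+1)%:R by [].
  have fA : lebesgue_rV (A n) \is a fin_num.
    rewrite ge0_fin_numE ?lebesgue_rV_ge0// lt_neqAle leey andbT.
    exact/eqP/Aoo.
  have [_ [C AC <-] Cx] := lb_ereal_inf_adherent en fA.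
  by exists C; split => //; exact: ltW.
apply: (@le_trans _ _ (\sum_(n <oo) \esum_(Q in C n) box_vol Q)%E); last first.
  apply: lee_nneseries => n _; last exact: (PC n).2.
  by move=> _; apply: esum_ge0 => Q _; exact: box_vol_ge0.
apply: (@le_trans _ _ (\esum_(Q in \bigcup_n C n) box_vol Q)%E).
  apply: ereal_inf_lbound; exists (\bigcup_n C n) => //; split.
    by apply: bigcup_countable => // n _; exact: (PC n).1.1.
  move=> y [n _ /(PC n).1.2 [Q CQ yQ]].
  by exists Q => //; exists n.
rewrite seqDU_bigcup_eq nneseries_sum_bigcup; last 2 first.
- exact: trivIset_seqDU.
- exact: box_vol_ge0.
apply: lee_nneseries => n _.
  by move=> *; apply: esum_ge0 => Q _; exact: box_vol_ge0.
apply: ereal_sup_le => _ [F [finF FS] <-]; exists F => //; split => //.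
by apply: subset_trans FS _; exact: subDsetl.
Qed.

HB.instance Definition _ := isOuterMeasure.Build R 'rV[R]_m lebesgue_rV
  lebesgue_rV0 lebesgue_rV_ge0 le_lebesgue_rV lebesgue_rV_sigma_subadditive.

End lebesgue_rV.

Definition euclidean_ball (R : realType) m (y : 'rV[R]_m) (r : R) :
    set 'rV[R]_m :=
  [set z | Num.sqrt (\sum_i (z ord0 i - y ord0 i) ^+ 2) < r].

(** * Maps of class C^k *)

(* Only used for finite-dimensional V, where continuity of all the iterated
   directional derivatives up to order k is the usual class C^k. *)
Fixpoint Ck_on (R : realType) (V W : normedModType R) (k : nat) (O : set V)
    (f : V -> W) : Prop :=
  (forall y, O y -> {for y, continuous f}) /\
  if k is k'.+1 then
    forall v, (forall y, O y -> derivable f y v) /\ Ck_on k' O ('D_v f)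
  else True.

Definition smooth_on (R : realType) (V W : normedModType R) (O : set V)
    (f : V -> W) := forall k, Ck_on k O f.

(** * Smooth manifolds *)

Section charts.
Context (R : realType) (m : nat) (T : topologicalType).

(* The values of [fwd] outside [dom] and of [bwd] outside [fwd @` dom] are
   irrelevant. *)
Record chart := Chart {
  dom : set T ;
  fwd : T -> 'rV[R]_m ;
  bwd : 'rV[R]_m -> T }.

Implicit Types c d : chart.

Definition chart_image c : set 'rV[R]_m := fwd c @` dom c.

Definition is_chart c :=
  [/\ open (dom c) /\ open (chart_image c),
      forall p, dom c p -> bwd c (fwd c p) = p,
      forall p, dom c p -> {for p, continuous (fwd c)},
      forall y, chart_image c y -> {for y, continuous (bwd c)} &
      compact (closure (dom c))].

Definition transition c d : 'rV[R]_m -> 'rV[R]_m := fwd d \o bwd c.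

Definition overlap c d : set 'rV[R]_m := fwd c @` (dom c `&` dom d).

Definition smooth_transition c d := smooth_on (overlap c d) (transition c d).

End charts.

(* [atlas] is the maximal atlas (among charts with relatively compact domain);
   [oriented_atlas] is a subatlas fixing the orientation, whereas a chart in
   [atlas] may reverse it. *)
Record manifold (R : realType) (m : nat) := Manifold {
  points :> ptopologicalType ;
  manifold_hausdorff : hausdorff_space points ;
  manifold_second_countable : @second_countable points ;
  manifold_connected : connected [set: points] ;
  atlas : set (chart R m points) ;
  atlas_chart : forall c, atlas c -> is_chart c ;
  atlas_cover : forall p, exists c, atlas c /\ dom c p ;
  atlas_smooth : forall c d, atlas c -> atlas d -> smooth_transition c d ;
  atlas_maximal : forall c, is_chart c ->
    (forall d, atlas d -> smooth_transition c d /\ smooth_transition d c) ->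
    atlas c ;
  oriented_atlas : set (chart R m points) ;
  oriented_atlas_sub : oriented_atlas `<=` atlas ;
  oriented_atlas_cover : forall p, exists c, oriented_atlas c /\ dom c p ;
  oriented_atlas_det : forall c d, oriented_atlas c -> oriented_atlas d ->
    forall y, overlap c d y -> 0 < \det (jacobian (transition c d) y) }.

(* The metric tensor is given by its Gram matrices in the charts, as functions
   of the coordinates; coordinate vectors are rows, so that [jacobian] acts on
   the right. *)
Record riemannian_metric (R : realType) (m : nat) (M : manifold R m) :=
  RiemannianMetric {
  gram :> chart R m M -> 'rV[R]_m -> 'M[R]_m ;
  gram_smooth : forall c, atlas c -> smooth_on (chart_image c) (gram c) ;
  gram_sym : forall c, atlas c -> forall y, chart_image c y ->
    (gram c y)^T = gram c y ;
  gram_posdef : forall c, atlas c -> forall y, chart_image c y ->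
    forall v : 'rV[R]_m, v != 0 -> 0 < (v *m gram c y *m v^T) ord0 ord0 ;
  gram_transition : forall c d, atlas c -> atlas d -> forall p, dom c p ->
    dom d p -> let J := jacobian (transition c d) (fwd c p) in
    gram c (fwd c p) = J *m gram d (fwd d p) *m J^T }.

Section manifold_theory.
Context (R : realType) (m : nat) (M : manifold R m).
Implicit Types (c d : chart R m M) (p q x : M) (s : R -> M).

(* T_pM is identified with R^m by the coordinate basis of the chart
   [chart_at p]. *)
Definition chart_at p : chart R m M := projT1 (cid (atlas_cover p)).

Definition velocity s (t : R) : 'rV[R]_m :=
  derive1 (fwd (chart_at (s t)) \o s : R -> 'rV[R]_m) t.

(* [I] is meant to be open. *)
Definition Ck_curve (k : nat) (I : set R) s :=
  (forall t, I t -> {for t, continuous s}) /\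
  forall c, atlas c ->
    Ck_on k (I `&` s @^-1` dom c) (fwd c \o s : R -> 'rV[R]_m).

Definition smooth_curve (I : set R) s := forall k, Ck_curve k I s.

(** ** Lebesgue measurable subsets of M *)

Definition manifold_measurable : set (set M) :=
  [set A | forall c, atlas c ->
    (@lebesgue_rV R m).-cara.-measurable (fwd c @` (A `&` dom c))].

Definition measurable_manifold := g_sigma_algebraType manifold_measurable.

Variable g : riemannian_metric M.

Definition gram_at p : 'M[R]_m := g (chart_at p) (fwd (chart_at p) p).

(** ** Riemannian distance and balls *)

Definition speed s (t : R) : R :=
  Num.sqrt ((velocity s t *m gram_at (s t) *m (velocity s t)^T) ord0 ord0).

(* A piecewise C^1 curve from p to q is a list of C^1 curves on [0, 1], each
   starting where the previous one ends. *)
Fixpoint piecewise_C1 p (ss : seq (R -> M)) q : Prop :=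
  if ss is s :: ss' then
    [/\ exists2 e : R, 0 < e & Ck_curve 1 `](- e), (1 + e)[ s,
        s 0 = p & piecewise_C1 (s 1) ss' q]
  else p = q.

Definition curve_length (ss : seq (R -> M)) : \bar R :=
  (\sum_(s <- ss) \int[lebesgue_measure]_(t in `[0%R, 1%R]) (speed s t)%:E)%E.

Definition riemannian_dist p q : \bar R :=
  ereal_inf [set curve_length ss | ss in [set ss | piecewise_C1 p ss q]].

Definition riemannian_ball x (r : R) : set M :=
  [set p | (riemannian_dist x p < r%:E)%E].

(** ** Geodesics, exponential map and normal charts *)

Definition christoffel c (y : 'rV[R]_m) (k i j : 'I_m) : R :=
  let dg (a b e : 'I_m) := 'D_(delta_mx ord0 a) (fun z => g c z b e) y in
  2^-1 * \sum_l invmx (g c y) k l * (dg i j l + dg j i l - dg l i j).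

Definition geodesic (I : set R) s :=
  smooth_curve I s /\
  forall c t, atlas c -> I t -> dom c (s t) ->
    let u : R -> 'rV[R]_m := fwd c \o s in
    forall k, (derive1 (derive1 u) t) ord0 k +
      \sum_i \sum_j christoffel c (u t) k i j *
        (derive1 u t) ord0 i * (derive1 u t) ord0 j = 0.

(* exp_x(v) is defined and equal to q; v is a tangent vector at x, in the
   coordinates of [chart_at x]. *)
Definition exp_map x (v : 'rV[R]_m) q :=
  exists s (e : R), [/\ 0 < e, geodesic `](- e), (1 + e)[ s, s 0 = x,
    velocity s 0 = v & s 1 = q].

(* The rows of B are the g_x-orthonormal basis of T_xM; [c] is the inverse of
   exp_x over [dom c], read in this basis. *)
Definition normal_chart x c :=
  [/\ atlas c, dom c x, fwd c x = 0 &
    exists B : 'M[R]_m, B *m gram_at x *m B^T = 1%:M /\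
      forall p, dom c p -> exp_map x (fwd c p *m B) p].

(** ** Volume measure and density *)

(* These conditions determine vol, since M is covered by countably many chart
   domains. *)
Definition is_volume (vol : {measure set measurable_manifold -> \bar R}) :=
  forall c (A : set M), atlas c -> manifold_measurable A -> A `<=` dom c ->
    vol A = (\int[@lebesgue_rV R m
                    : set (caratheodory_type (@lebesgue_rV R m)) -> \bar R]_(
                 y in fwd c @` A) (Num.sqrt (\det (g c y)))%:E)%E.

Definition density_ratio (vol : set M -> \bar R) (E : set M) x (r : R) : R :=
  fine (vol (E `&` riemannian_ball x r)) / fine (vol (riemannian_ball x r)).

Definition density (vol : set M -> \bar R) (E : set M) x : R :=
  lim (density_ratio vol E x r @[r --> 0^'+]).

End manifold_theory.

Definition euclidean_density_ratio (R : realType) m (A : set 'rV[R]_m)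
    (y : 'rV[R]_m) (r : R) : R :=
  fine (lebesgue_rV (A `&` euclidean_ball y r)) / fine (lebesgue_rV (euclidean_ball y r)).

Definition euclidean_density (R : realType) m (A : set 'rV[R]_m)
    (y : 'rV[R]_m) : R :=
  lim (euclidean_density_ratio A y r @[r --> 0^'+]).

(* Main.v *)
Require Import Defs.
From HB Require Import structures.
From mathcomp Require Import all_boot all_order all_algebra.
From mathcomp Require Import all_classical all_reals all_analysis.
From mathcomp Require Import ring lra.

Set Implicit Arguments.
Unset Strict Implicit.
Unset Printing Implicit Defensive.

Import Order.TTheory GRing.Theory Num.Theory.
Import numFieldNormedType.Exports.

Local Open Scope classical_set_scope.
Local Open Scope ring_scope.

(** Densities only see the metric to zeroth order at the base point. In a normal
chart [phi] centered in [x] the Gram matrix is the identity at the origin, and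
it is continuous; hence for every [eps > 0], on a small Euclidean ball, lengths
of tangent vectors and the volume density differ from the Euclidean ones by
factors between [1 - eps] and [1 + eps] ([small_distortion_exists]).

The image of the Riemannian ball of radius [r] then lies between the Euclidean
balls of radii [r / (1 + eps)] and [r / (1 - eps)]. The first inclusion follows
by measuring straight segments ([riemannian_dist_center_le]); the second one
holds because along any curve the Euclidean distance to the origin, clipped so
that it makes sense on all of [M], cannot grow faster than the speed divided by
[1 - eps] ([riemannian_dist_ge_chart_radius]). Consequently the volume of
[E `&` B(x, r)] and the Lebesgue measure of [phi(E) `&` B(0, r)] differ by
[o(r^m)] ([riemannian_ball_mass_approx]). Using this for [E] and for the whole
manifold, the two density ratios differ by [o(1)], so that one converges if and
only if the other does, and to the same limit.

That the Gram matrix at the origin is the identity ([normal_chart_gram]) comes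
from the geodesic equation [u'' = - Gamma(u)(u', u')]: its right-hand side is
quadratic in the velocity, so a geodesic with small initial velocity [w] ends
at [u(0) + w + O(|w|^2)]; a continuity argument on [0, 1] keeps its position
and velocity under control until then ([geodesic_endpoint_estimate]). The
differential at the origin of the change of coordinates from [phi] to the chart
defining [T_xM] is therefore the orthonormal frame of the normal chart.

On the Lebesgue side three facts about the outer measure defined by box covers
are needed: open sets are Caratheodory measurable, dilations scale the measure
by the [m]-th power of the factor, and bounded sets have finite measure. *)

(** * Lebesgue outer measure on row vectors *)

(** The integral of a nonnegative function is a supremum over the simple
functions below it, so it is monotone for arbitrary integrands. *)
Lemma le_integral_nonneg d (T : measurableType d) (R : realType)
    (mu : {measure set T -> \bar R}) (D : set T) (f g : T -> \bar R) :
  (forall x, D x -> (0 <= f x <= g x)%E) ->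
  (\int[mu]_(x in D) f x <= \int[mu]_(x in D) g x)%E.
Proof.
move=> fg; rewrite !ge0_integralE => [|x /fg/andP[f0 fgx]|x /fg/andP[]//].
  apply: ereal_sup_le => _ [h hf <-]; exists h => // x; apply: le_trans (hf x) _.
  by rewrite /patch; case: ifPn => // /[!inE] /fg/andP[].
exact: le_trans fgx.
Qed.

Section lebesgue.
Context (R : realType) (m : nat).
Implicit Types (Q : 'rV[R]_m * 'rV[R]_m) (A : set 'rV[R]_m).

Lemma subset_esum (T : choiceType) (I J : set T) (a : T -> \bar R) :
  I `<=` J -> (\esum_(i in I) a i <= \esum_(i in J) a i)%E.
Proof.
move=> IJ; apply: ereal_sup_le => _ [F [finF FI] <-]; exists F => //.
by split => //; exact: subset_trans IJ.
Qed.

(** Choosing one preimage of each point of the image turns the left-hand side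
into a subsum of the right-hand side. *)
Lemma esum_image_le (T T' : pointedType) (C : set T) (f : T -> T') (a : T' -> \bar R) :
  (\esum_(Q in f @` C) a Q <= \esum_(Q in C) a (f Q))%E.
Proof.
pose h P : T := get [set Q | C Q /\ f Q = P].
have hP P : (f @` C) P -> C (h P) /\ f (h P) = P.
  by move=> [Q CQ fQ]; apply: (@getPex _ [set Q | C Q /\ f Q = P]); exists Q.
have -> : \esum_(Q in f @` C) a Q = \esum_(Q in h @` (f @` C)) a (f Q).
  rewrite (esum_image _ h); first by apply: eq_esum => P /hP[_ ->].
  move=> P P' /[!inE] /hP[_ hP1] /hP[_ hP2] e.
  by rewrite -hP1 e hP2.
by apply: subset_esum => _ [P /hP[]] + _ <-.
Qed.

(** A cover may be modified box by box by a map that need not be injective;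
dilations and cuts by hyperplanes are treated in this way. *)
Lemma lebesgue_rV_le_esum (C : set ('rV[R]_m * 'rV[R]_m))
    (f : 'rV[R]_m * 'rV[R]_m -> 'rV[R]_m * 'rV[R]_m) A :
  countable C -> A `<=` \bigcup_(Q in C) box (f Q) ->
  (lebesgue_rV A <= \esum_(Q in C) box_vol (f Q))%E.
Proof.
move=> cC AC; apply: le_trans (esum_image_le _ _ _).
apply: ereal_inf_lbound; exists (f @` C) => //; split.
  exact: (card_le_trans (card_image_le _ _)).
by move=> y /AC[Q CQ yQ]; exists (f Q) => //; exists Q.
Qed.

Definition dilate (l : R) A : set 'rV[R]_m := [set l *: y | y in A].

Lemma lebesgue_rV_dilate_le (l : R) A : 0 < l ->
  (lebesgue_rV (dilate l A) <= (l ^+ m)%:E * lebesgue_rV A)%E.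
Proof.
move=> l0; have lm0 : 0 < l ^+ m by rewrite exprn_gt0.
rewrite /lebesgue_rV -ereal_inf_pZl//.
apply: le_ereal_inf_tmp => _ [_ [C [cC AC] <-] <-].
pose f (Q : 'rV[R]_m * 'rV[R]_m) := (l *: Q.1, l *: Q.2).
apply: (@le_trans _ _ (\esum_(Q in C) box_vol (f Q))).
  apply: lebesgue_rV_le_esum => // _ [y /AC[Q CQ yQ] <-].
  exists Q => // i; have /andP[y1 y2] := yQ i.
  by rewrite !mxE ltr_pM2l// ler_pM2l// y1 y2.
have boxZ Q : box_vol (f Q) = ((l ^+ m)%:E * box_vol Q)%E.
  rewrite /box_vol -EFinM; congr (_%:E).
  rewrite -[X in l ^+ X]card_ord -prodr_const -big_split/=.
  by apply: eq_bigr => i _; rewrite !mxE -mulrBr maxr_pMr ?mulr0// ltW.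
rewrite [in leRHS]/esum -ereal_sup_pZl//; apply: ereal_sup_le => _ [F FC <-].
exists (\sum_(Q \in F) box_vol Q)%E; first by exists F.
rewrite ge0_mule_fsumr; last by move=> Q; exact: box_vol_ge0.
by apply: eq_fsbigr => Q _.
Qed.

Lemma lebesgue_rV_dilate (l : R) A : 0 < l ->
  lebesgue_rV (dilate l A) = ((l ^+ m)%:E * lebesgue_rV A)%E.
Proof.
move=> l0; have l'0 : 0 < l^-1 by rewrite invr_gt0.
have lm0 : 0 < l ^+ m by rewrite exprn_gt0.
apply/eqP; rewrite eq_le lebesgue_rV_dilate_le//=.
have AE : A = dilate l^-1 (dilate l A).
  apply/seteqP; split => [y Ay|_ [_ [y Ay <-] <-]].
    exists (l *: y); first by exists y.
    by rewrite scalerA mulVf ?gt_eqF// scale1r.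
  by rewrite scalerA mulVf ?gt_eqF// scale1r.
rewrite {1}AE; apply: (@le_trans _ _
    ((l ^+ m)%:E * ((l^-1 ^+ m)%:E * lebesgue_rV (dilate l A)))%E).
  by apply: lee_wpmul2l; [rewrite lee_fin ltW|exact: lebesgue_rV_dilate_le].
by rewrite muleA -EFinM -exprMn mulfV ?gt_eqF// expr1n mul1e.
Qed.

Lemma lebesgue_rV_bounded_lt_pinfty (a : R) A : 0 < a ->
  (forall y, A y -> forall i, `|y ord0 i| < a) -> (lebesgue_rV A < +oo)%E.
Proof.
move=> a0 Aa; pose Q : 'rV[R]_m * 'rV[R]_m := (const_mx (- a), const_mx a).
apply: (@le_lt_trans _ _ (box_vol Q)); last exact: ltry.
apply: ereal_inf_lbound; exists [set Q]; last first.
  by rewrite esum_set1//; exact: box_vol_ge0.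
split=> [|y Ay]; first exact: countable1.
exists Q => // i; have := Aa _ Ay i; rewrite !mxE ltr_norml => /andP[-> /ltW ->//].
Qed.

(** A hyperplane orthogonal to a coordinate axis cuts every box of a cover into
two boxes, whose volumes add up to at most that of the original box. *)
Lemma measurable_halfspace i (a : R) :
  (@lebesgue_rV R m).-cara.-measurable [set y : 'rV[R]_m | y ord0 i <= a].
Proof.
apply: le_caratheodory_measurable => X; set H := [set y | _].
apply: le_ereal_inf_tmp => _ [C [cC XC] <-].
pose f Q : 'rV[R]_m * 'rV[R]_m :=
  (Q.1, \row_j if j == i then Num.min (Q.2 ord0 j) a else Q.2 ord0 j).
pose h Q : 'rV[R]_m * 'rV[R]_m :=
  (\row_j if j == i then Num.max (Q.1 ord0 j) a else Q.1 ord0 j, Q.2).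
apply: (@le_trans _ _ (\esum_(Q in C) box_vol (f Q) +
                       \esum_(Q in C) box_vol (h Q))%E).
  apply: leeD; apply: lebesgue_rV_le_esum => // y [/XC[Q CQ yQ]].
    rewrite /H/= => yH; exists Q => // j; have /andP[y1 y2] := yQ j.
    by rewrite /= mxE y1/=; case: eqP => // ->; rewrite le_min yH andbT;
      have /andP[] := yQ i.
  rewrite /H/= => /negP; rewrite -ltNge => yH; exists Q => // j.
  have /andP[y1 y2] := yQ j; rewrite /= mxE y2 andbT.
  by case: eqP => // ->; rewrite gt_max yH andbT; have /andP[] := yQ i.
rewrite -esumD => [|Q _|Q _]; [|exact: box_vol_ge0..].
apply: le_esum => Q _; rewrite /box_vol -EFinD lee_fin.
rewrite (bigD1 i)//= [X in _ + X <= _](bigD1 i)//= [leRHS](bigD1 i)//=.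
rewrite (eq_bigr (fun j => Num.max 0 (Q.2 ord0 j - Q.1 ord0 j))); last first.
  by move=> j /negPf ji; rewrite !mxE ji.
rewrite [X in _ + _ * X <= _](eq_bigr
  (fun j => Num.max 0 (Q.2 ord0 j - Q.1 ord0 j))); last first.
  by move=> j /negPf ji; rewrite !mxE ji.
rewrite -mulrDl ler_wpM2r//.
  by rewrite prodr_ge0// => j _; rewrite le_max lexx.
rewrite !mxE eqxx.
set p := Q.1 ord0 i; set q := Q.2 ord0 i; clearbody p q.
case: (leP q a) => qa; case: (leP p a) => pa.
- by rewrite [Num.max 0 (q - a)]max_l ?addr0// subr_le0.
- by rewrite [Num.max 0 (q - p)]max_l ?add0r// subr_le0 (le_trans qa)// ltW.
- rewrite [Num.max 0 (a - p)]max_r ?[Num.max 0 (q - a)]max_r ?[Num.max 0 (q - p)]max_r; lra.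
- rewrite [Num.max 0 (a - p)]max_l ?add0r//; lra.
Qed.

Lemma measurable_box Q : (@lebesgue_rV R m).-cara.-measurable (box Q).
Proof.
have -> : box Q = \bigcap_(i in [set: 'I_m])
    ([set y : 'rV[R]_m | y ord0 i <= Q.2 ord0 i] `\`
     [set y : 'rV[R]_m | y ord0 i <= Q.1 ord0 i]).
  apply/seteqP; split => [y yQ i _|y yQ i] /=.
    by have /andP[y1 y2] := yQ i; split => //; apply/negP; rewrite -ltNge.
  by have [/= -> /negP] := yQ i I; rewrite -ltNge => ->.
apply: (@fin_bigcap_measurable _ (caratheodory_type (@lebesgue_rV R m))) => // i _.
by apply: measurableD; exact: measurable_halfspace.
Qed.

(** An open set is the countable union of the boxes with rational corners that
it contains. *)
Lemma open_measurable_rV (U : set 'rV[R]_m) : open U ->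
  (@lebesgue_rV R m).-cara.-measurable U.
Proof.
move=> oU; pose bq (q : 'rV[rat]_m * 'rV[rat]_m) :=
  box (map_mx ratr q.1 : 'rV[R]_m, map_mx ratr q.2 : 'rV[R]_m).
pose F q := if `[< bq q `<=` U >] then bq q else set0.
have -> : U = \bigcup_q F q; last first.
  apply: (@countable_bigcupT_measurable _ (caratheodory_type (@lebesgue_rV R m))).
    exact: countableP.
  move=> q; rewrite /F; case: asboolP => _; first exact: measurable_box.
  exact: measurable0.
apply/seteqP; split => [y Uy|y [q _]]; last first.
  by rewrite /F; case: asboolP => [sub|_] yq; [exact: sub|].
have /nbhs_ballP[e /= e0 yU] : nbhs y U by apply: open_nbhs_nbhs; split.
have [p pP] : {p : 'I_m -> rat & forall i, ratr (p i) \in `]y ord0 i - e / 2, y ord0 i[}.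
  apply: (@choice _ _ (fun i q => ratr q \in `]y ord0 i - e / 2, y ord0 i[)) => i.
  by apply/rat_in_itvoo; lra.
have [q qP] : {q : 'I_m -> rat & forall i, ratr (q i) \in `]y ord0 i, y ord0 i + e / 2[}.
  apply: (@choice _ _ (fun i q => ratr q \in `]y ord0 i, y ord0 i + e / 2[)) => i.
  by apply/rat_in_itvoo; lra.
exists (\row_i p i, \row_i q i) => //; rewrite /F.
case: asboolP => [_|]/=.
  move=> i /=; rewrite !mxE; have := pP i; have := qP i.
  by rewrite !in_itv/= => /andP[? ?] /andP[? ?]; lra.
case => z zb; apply: yU; split => // i0 i; rewrite (ord1 i0).
have := zb i; rewrite /= !mxE; have := pP i; have := qP i.
rewrite !in_itv/= /ball/= => /andP[? ?] /andP[? ?] /andP[? ?].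
by rewrite ltr_norml; lra.
Qed.

Lemma integral_between (f : 'rV[R]_m -> R) (a b : R) A :
  (@lebesgue_rV R m).-cara.-measurable A -> 0 <= a ->
  (forall y, A y -> a <= f y <= b) ->
  (a%:E * lebesgue_rV A <=
    \int[@lebesgue_rV R m : set (caratheodory_type (@lebesgue_rV R m)) -> \bar R]_(y in A) (f y)%:E
    <= b%:E * lebesgue_rV A)%E.
Proof.
move=> mA a0 fab.
pose mu0 : {outer_measure set 'rV[R]_m -> \bar R} := @lebesgue_rV R m.
pose mu : {measure set (caratheodory_type mu0) -> \bar R} :=
  (mu0 : set (caratheodory_type mu0) -> \bar R).
have intc c : (c%:E * lebesgue_rV A = \int[mu]_(y in A) c%:E)%E.
  by rewrite (@integral_cst _ _ _ mu).
rewrite !intc.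
apply/andP; split; apply: (@le_integral_nonneg _ _ _ mu) => y Ay;
  have /andP[af fb] := fab _ Ay; rewrite !lee_fin.
  by rewrite a0 af.
by rewrite (le_trans a0 af) fb.
Qed.

End lebesgue.

(** * Limits of matrices *)

Section matrix_limits.
Context (R : realType).

Lemma mx_norm_leP m n (A : 'M[R]_(m, n)) (K : R) : 0 <= K ->
  (forall i j, `|A i j| <= K) -> `|A| <= K.
Proof.
move=> K0 AK; rewrite /Num.Def.normr/= mx_normrE.
by apply: bigmax_le => // -[i j] _; exact: AK.
Qed.

Lemma coord_le_mx_norm m n (A : 'M[R]_(m, n)) i j : `|A i j| <= `|A|.
Proof.
rewrite [leRHS]/Num.Def.normr/= mx_normrE.
exact: (@le_bigmax _ _ _ 0 (fun ij => `|A ij.1 ij.2|) (i, j)).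
Qed.

Context (T : Type) (F : set_system T) (FF : Filter F).

Lemma cvg_mx_coord m n (f : T -> 'M[R]_(m, n)) (l : 'M[R]_(m, n)) :
  (forall i j, f x i j @[x --> F] --> l i j) -> f x @[x --> F] --> l.
Proof.
move=> fl; apply/cvgrPdist_le => /= e e0.
have : \forall x \near F, forall ij : 'I_m * 'I_n, `|l ij.1 ij.2 - f x ij.1 ij.2| <= e.
  by apply: filter_forall => ij; move/cvgrPdist_le : (fl ij.1 ij.2); apply.
apply: filterS => x xe; apply: mx_norm_leP => [|i j]; first exact: ltW.
by rewrite !mxE; exact: (xe (i, j)).
Qed.

Lemma cvg_coord m n (f : T -> 'M[R]_(m, n)) (l : 'M[R]_(m, n)) i j :
  f x @[x --> F] --> l -> f x i j @[x --> F] --> l i j.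
Proof. by move=> fl; exact: (cvg_comp _ _ fl (@coord_continuous _ m n i j l)). Qed.

Lemma cvg_sum_seq (I : Type) (r : seq I) (P : pred I) (f : I -> T -> R) (l : I -> R) :
  (forall i, P i -> f i x @[x --> F] --> l i) ->
  \sum_(i <- r | P i) f i x @[x --> F] --> \sum_(i <- r | P i) l i.
Proof. by move=> fl; apply: cvg_big => //; exact: add_continuous. Qed.

Lemma cvg_prod_seq (I : Type) (r : seq I) (P : pred I) (f : I -> T -> R) (l : I -> R) :
  (forall i, P i -> f i x @[x --> F] --> l i) ->
  \prod_(i <- r | P i) f i x @[x --> F] --> \prod_(i <- r | P i) l i.
Proof. by move=> fl; apply: cvg_big => //; exact: mul_continuous. Qed.

Lemma cvg_mulmx m n p (f : T -> 'M[R]_(m, n)) (g : T -> 'M[R]_(n, p))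
    (a : 'M[R]_(m, n)) (b : 'M[R]_(n, p)) :
  f x @[x --> F] --> a -> g x @[x --> F] --> b ->
  f x *m g x @[x --> F] --> a *m b.
Proof.
move=> fa gb; apply: cvg_mx_coord => i j; rewrite mxE.
under eq_fun do rewrite mxE.
by apply: cvg_sum_seq => k _; apply: cvgM; exact: cvg_coord.
Qed.

Lemma cvg_trmx m n (f : T -> 'M[R]_(m, n)) (a : 'M[R]_(m, n)) :
  f x @[x --> F] --> a -> (f x)^T @[x --> F] --> a^T.
Proof.
move=> fa; apply: cvg_mx_coord => i j; rewrite mxE.
by under eq_fun do rewrite mxE; exact: cvg_coord.
Qed.

Lemma cvg_det n (f : T -> 'M[R]_n) (a : 'M[R]_n) :
  f x @[x --> F] --> a -> \det (f x) @[x --> F] --> \det a.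
Proof.
move=> fa; apply: cvg_sum_seq => s _; apply: cvgM; first exact: cvg_cst.
by apply: cvg_prod_seq => i _; exact: cvg_coord.
Qed.

Lemma cvg_invmx n (f : T -> 'M[R]_n) (a : 'M[R]_n) : a \in unitmx ->
  f x @[x --> F] --> a -> invmx (f x) @[x --> F] --> invmx a.
Proof.
move=> ua fa; have da0 : \det a != 0 by rewrite unitmxE unitfE in ua.
have cadj : (\det (f x))^-1 *: \adj (f x) @[x --> F] --> (\det a)^-1 *: \adj a.
  apply: cvg_mx_coord => i j; rewrite mxE; under eq_fun do rewrite mxE.
  apply: cvgM; first by apply: cvgV => //; exact: cvg_det.
  rewrite mxE; under eq_fun do rewrite mxE.
  apply: cvgM; first exact: cvg_cst.
  apply: cvg_det; apply: cvg_mx_coord => k l.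
  by rewrite !mxE; under eq_fun do rewrite !mxE; exact: cvg_coord.
rewrite {2}/invmx ua; apply: cvg_trans cadj; apply: near_eq_cvg.
have : \forall x \near F, \det (f x) != 0.
  have /cvgrPdist_lt/(_ `|\det a|) := cvg_det fa.
  rewrite normr_gt0 => /(_ da0); apply: filterS => x.
  by apply: contraTneq => ->; rewrite subr0 ltxx.
by apply: filterS => x dx; rewrite /invmx unitmxE unitfE dx.
Qed.

End matrix_limits.

(** * Induction along a segment and mean value estimates *)

Section segment_induction.
Context (R : realType).

(** If [P] failed somewhere, let [s] be the infimum of the failures: the first
closure property gives [P] at [s], the second one gives it just after [s]. This is used
where a trajectory has to be followed as long as it stays in a chart. *)
Lemma segment_induction (P : R -> Prop) : P 0 ->
  (forall t, 0 < t <= 1 -> (forall s, 0 <= s < t -> P s) -> P t) ->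
  (forall t, 0 <= t < 1 -> (forall s, 0 <= s <= t -> P s) ->
    \forall s \near t^'+, P s) ->
  forall t, 0 <= t <= 1 -> P t.
Proof.
move=> P0 Pleft Pright t0 t01; apply: contrapT => nPt0.
pose S := [set t | 0 <= t <= 1 /\ ~ P t].
have infS : has_inf S.
  by split; [exists t0|exists 0 => t [/andP[]]].
pose s := inf S.
have s0 : 0 <= s by apply: lb_le_inf; [exact: infS.1|move=> t [/andP[]]].
have st t : 0 <= t <= 1 -> ~ P t -> s <= t.
  by move=> t1 nPt; apply: ge_inf; [exact: infS.2|].
have s1 : s <= 1 by apply: (le_trans (st _ t01 nPt0)); case/andP: t01.
have Plt t : 0 <= t < s -> P t.
  move=> /andP[t_ge0 ts]; apply: contrapT => nPt.
  have /st : 0 <= t <= 1 by rewrite t_ge0 (le_trans (ltW ts)).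
  by move=> /(_ nPt); rewrite leNgt ts.
have Ps : P s.
  move: s0; rewrite le_eqVlt => /predU1P[<-//|s_gt0].
  by apply: Pleft => //; rewrite s_gt0.
have Ple t : 0 <= t <= s -> P t.
  by rewrite [t <= _]le_eqVlt => /andP[t_ge0 /predU1P[->//|ts]]; apply: Plt; rewrite t_ge0.
have s_lt1 : s < 1.
  rewrite lt_neqAle s1 andbT; apply/eqP => s_eq1; apply: nPt0.
  by apply: Ple; rewrite s_eq1.
have /Pright/(_ Ple) : 0 <= s < 1 by rewrite s0.
move=> /nbhs_ballP[e /= e0 Pe].
have [t [t1 nPt] te] := inf_adherent e0 infS.
have t_ge0 : 0 <= t by case/andP: t1.
apply: nPt; have [ts|s_lt_t] := leP t s; first by apply: Ple; rewrite t_ge0.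
by apply: Pe => //; rewrite /ball/= ltr_norml; rewrite -/s in te; lra.
Qed.

(** A form of the mean value inequality for functions that are not
differentiable, such as a norm that vanishes somewhere or a clipped distance:
a one-sided estimate of the increments is enough, by induction along the
segment for every slope [e] and then by letting [e] tend to 0. *)
Lemma nonincreasing_endpoints (f : R -> R) :
  (forall t e, 0 < t <= 1 -> 0 < e -> \forall s \near t^'-, f t <= f s + e) ->
  (forall t e, 0 <= t < 1 -> 0 < e ->
    \forall s \near t^'+, f s <= f t + e * (s - t)) ->
  f 1 <= f 0.
Proof.
move=> fl fr; apply/ler_addgt0Pr => e e0.
suff : forall t, 0 <= t <= 1 -> f t <= f 0 + e * t.
  by move/(_ 1); rewrite ler01 lexx mulr1; apply.
apply: segment_induction => [|t t01 fs|t t01 fs]; first by rewrite mulr0 addr0.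
  apply/ler_addgt0Pr => d d0.
  have t0 : 0 < t by case/andP: t01.
  near (t^'-) => s.
  have ft : f t <= f s + d by near: s; exact: fl.
  have s0 : 0 < s by near: s; exact: nbhs_left_gt.
  have st : s < t by near: s; exact: nbhs_left_lt.
  have fs0 : f s <= f 0 + e * s by apply: fs; rewrite (ltW s0) st.
  have : e * s <= e * t by rewrite ler_pM2l// ltW.
  lra.
have ft : f t <= f 0 + e * t by apply: fs; rewrite lexx andbT; case/andP: t01.
by have := fr _ _ t01 e0; apply: filterS => s; rewrite mulrBr; lra.
Unshelve. all: by end_near. Qed.

End segment_induction.

Section vector_mean_value.
Context (R : realType).

(** The norm on row vectors is the supremum norm, so the scalar mean value
theorem can be applied to each coordinate without losing a constant. *)
Lemma mean_value_rV n (u : R -> 'rV[R]_n) (w : 'rV[R]_n) (K a b : R) : a <= b ->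
  (forall t, a <= t <= b -> derivable u t 1) ->
  (forall t, a <= t <= b -> `|'D_1 u t - w| <= K) ->
  `|u b - u a - (b - a) *: w| <= K * (b - a).
Proof.
move=> ab du uK; have K0 : 0 <= K by apply: le_trans (uK a _); rewrite // lexx.
apply: mx_norm_leP => [|i j]; first by rewrite mulr_ge0 ?subr_ge0.
rewrite (ord1 i) {i}; pose f t := u t ord0 j - t * w ord0 j.
have df t : a <= t <= b -> is_derive t 1 f ('D_1 u t ord0 j - w ord0 j).
  move=> tab; have dut := du _ tab.
  rewrite derive_mx// mxE; apply: is_deriveB.
    by apply: derivableP; move/derivable_mxP : dut; apply.
  apply: (@near_eq_is_derive _ _ _ (w ord0 j \*: id)).
    by near=> s; rewrite /= [LHS]mulrC.
  by apply: is_derive_eq; rewrite [LHS]mulr1.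
have [c cab cab_eq] : exists2 c, c \in `[a, b] &
    f b - f a = ('D_1 u c ord0 j - w ord0 j) * (b - a).
  apply: (@MVT_segment _ f (fun t => 'D_1 u t ord0 j - w ord0 j)) => //.
    by move=> t; rewrite in_itv/= => /andP[at_ tb]; apply: df; rewrite !ltW.
  apply: derivable_within_continuous => t; rewrite in_itv/= => tab.
  by have [] := df _ tab.
rewrite in_itv/= in cab.
have -> : (u b - u a - (b - a) *: w) ord0 j = f b - f a by rewrite !mxE /f; ring.
rewrite cab_eq normrM [`|b - a|]ger0_norm ?subr_ge0//.
rewrite ler_wpM2r ?subr_ge0//; apply: le_trans (uK _ cab).
by apply: le_trans (coord_le_mx_norm _ ord0 j); rewrite !mxE.
Unshelve. all: by end_near. Qed.

End vector_mean_value.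
(** * Differentiability of maps of class C^1 *)

Section continuously_differentiable.
Context (R : realType).

Lemma is_derive_line (V W : normedModType R) (f : V -> W) (a v : V) (t : R) :
  derivable f (a + t *: v) v ->
  is_derive t (1 : R) (fun s => f (a + s *: v)) ('D_v f (a + t *: v)).
Proof.
have E : (fun h : R => h^-1 *: (f (h *: v + (a + t *: v)) - f (a + t *: v))) =
         (fun h : R => h^-1 *: (f (a + (h *: (1 : R) + t) *: v) - f (a + t *: v))).
  apply/funext => h; congr (_ *: (f _ - _)).
  by rewrite [h *: 1]mulr1 scalerDl addrCA.
by move=> df; split; rewrite /derivable /derive -E.
Qed.

Lemma is_derive_scale_dir (V W : normedModType R) (f : V -> W) (a v : V) (c : R) :
  derivable f a v -> is_derive a (c *: v) f (c *: 'D_v f a).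
Proof.
move=> df; have [->|c0] := eqVneq c 0; first by rewrite !scale0r; exact: is_derive0.
suff fcv : (h^-1 *: (f (h *: (c *: v) + a) - f a)) @[h --> (0 : R)^'] --> c *: 'D_v f a.
  by apply: DeriveDef; [apply/cvg_ex; exists (c *: 'D_v f a)|exact: cvg_lim].
have -> : (fun h : R => h^-1 *: (f (h *: (c *: v) + a) - f a)) =
    (fun h => c *: ((h * c)^-1 *: (f ((h * c) *: v + a) - f a))).
  by apply/funext => h; rewrite !scalerA invfM mulrCA mulfV// mulr1.
have hc0 : h * c @[h --> (0 : R)^'] --> (0 : R)^'.
  move=> A /nbhs_ballP[e /= e0 eA]; apply/nbhs_ballP.
  exists (e / `|c|) => /=; first by rewrite divr_gt0// normr_gt0.
  move=> h; rewrite /ball/= sub0r normrN ltr_pdivlMr ?normr_gt0// => he h0.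
  by apply: eA; [rewrite /ball/= sub0r normrN normrM|rewrite /= mulf_neq0].
have fd := cvg_comp _ _ hc0 df.
exact: cvgZ (cvg_cst c) fd.
Qed.

Lemma differentiable_of_linear_approx (V W : normedModType R) (f : V -> W)
    (df : {linear V -> W}) (a : V) : continuous df ->
  (forall e : R, 0 < e -> \forall h \near (0 : V),
    `|f (a + h) - f a - df h| <= e * `|h|) ->
  differentiable f a.
Proof.
move=> cdf fdf; apply/diffP => /=.
apply: (@getPex _ (fun (df : {linear V -> W}) => continuous df /\
  forall y, f y = f (lim (nbhs a)) + df (y - lim (nbhs a))
                  +o_(y \near a) (y - lim (nbhs a)))).
exists df; split => //.
have fE : f = (fun y => f a + df (y - a)) +o_ (nbhs a) (fun y => y - a).
  apply/eqaddoP => e e0; have /nbhs_ballP[d /= d0 fd] := fdf _ e0.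
  apply/nbhs_ballP; exists d => //= y; rewrite -ball_normE/= => ayd.
  have : ball (0 : V) d (y - a) by rewrite -ball_normE/= sub0r normrN distrC.
  by move=> /fd; rewrite [a + _]addrC subrK -addrA -opprD.
by rewrite lim_id// => y; exact: (congr1 (@^~ y) fE).
Qed.

(** Go from [a] to [a + h] parallel to the coordinate axes. Along each step the
increment is estimated by the mean value inequality, with a slope close to the
partial derivative at [a] since the whole path stays in the supremum norm ball
of radius [|h|] around [a]. *)
Lemma C1_differentiable m n (f : 'rV[R]_m -> 'rV[R]_n) (O : set 'rV[R]_m) a :
  nbhs a O -> Ck_on 1 O f -> differentiable f a.
Proof.
move=> aO [_ fC1].
pose D k : 'rV[R]_n := 'D_(delta_mx ord0 k) f a.
pose A : 'M[R]_(m, n) := \matrix_k D k.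
have AE (h : 'rV[R]_m) : h *m A = \sum_k h ord0 k *: D k.
  by rewrite mulmx_sum_row; apply: eq_bigr => k _; rewrite rowK.
apply: (@differentiable_of_linear_approx _ _ f (mulmxr A)).
  move=> h; apply: (@cvg_mulmx R _ (nbhs h) _ _ _ _ id (cst A) h A) => //; exact: cvg_cst.
move=> e e0; (* There are [m] steps, each with an error of at most [e' * |h|]. *)
pose e' := e / m.+1%:R.
have e'0 : 0 < e' by rewrite divr_gt0.
have near_D : \forall y \near a,
    forall k : 'I_m, `|'D_(delta_mx ord0 k) f y - D k| <= e'.
  apply: (@filter_forall _ _ (fun (k : 'I_m) y =>
    `|'D_(delta_mx ord0 k) f y - D k| <= e') (nbhs a) (nbhs_filter a)) => k.
  have [_ [+ _]] := fC1 (delta_mx ord0 k).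
  move=> /(_ a (nbhs_singleton aO)) /cvgrPdist_le/(_ _ e'0).
  by apply: filterS => y; rewrite distrC.
have : nbhs a (O `&` [set y | forall k, `|'D_(delta_mx ord0 k) f y - D k| <= e']).
  exact: filterI.
move=> /nbhs_ballP[d /= d0 ad].
apply/nbhs_ballP; exists d => // h; rewrite -ball_normE/= sub0r normrN => hd.
(* The vertices [a + p k] of the path from [a] to [a + h]. *)
pose p k : 'rV[R]_m := \row_j (if (j < k)%N then h ord0 j else 0).
have pS (k : 'I_m) : p k.+1 = p k + h ord0 k *: delta_mx ord0 k.
  apply/rowP => j; rewrite !mxE eqxx/= eq_sym ltnS leq_eqVlt.
  rewrite -(inj_eq val_inj)/=; case: (ltngtP (val j) (val k)) => /= [_|_|jk].
  - by rewrite mulr0 addr0.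
  - by rewrite mulr0 addr0.
  - by rewrite mulr1 add0r; congr (h _ _); apply/val_inj.
have pin (k : 'I_m) (t : R) : 0 <= t <= 1 ->
    ball a d (a + (p k + t *: (h ord0 k *: delta_mx ord0 k))).
  move=> /andP[t0 t1]; rewrite -ball_normE/= opprD addrA subrr sub0r normrN.
  apply: le_lt_trans hd; apply: mx_norm_leP => // i j.
  rewrite (ord1 i) !mxE eqxx/=; case: ltnP => jk.
    by rewrite (_ : j == k = false) ?mulr0 ?addr0 ?coord_le_mx_norm//;
      apply/eqP => jk'; move: jk; rewrite jk' ltnn.
  rewrite add0r; case: eqP => [_|_]; last by rewrite !mulr0 normr0.
  rewrite mulr1 normrM (ger0_norm t0).
  by apply: le_trans (coord_le_mx_norm h ord0 k); rewrite ler_piMl.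
have step (k : 'I_m) :
    `|f (a + p k.+1) - f (a + p k) - h ord0 k *: D k| <= e' * `|h|.
  pose v : 'rV[R]_m := h ord0 k *: delta_mx ord0 k.
  have dv (t : R) : 0 <= t <= 1 ->
      is_derive t (1 : R) (fun s => f (a + p k + s *: v))
        (h ord0 k *: 'D_(delta_mx ord0 k) f (a + p k + t *: v)).
    move=> /(pin k); rewrite addrA => /ad[Oy _].
    have [/(_ _ Oy) dfv _] := fC1 (delta_mx ord0 k).
    have [dfhv <-] := is_derive_scale_dir (h ord0 k) dfv.
    exact: is_derive_line.
  have := @mean_value_rV R n (fun s => f (a + p k + s *: v)) (h ord0 k *: D k)
    (e' * `|h|) 0 1 ler01.
  have pSv : a + p k + v = a + p k.+1 by rewrite pS addrA.
  rewrite /= subr0 mulr1 !scale1r scale0r addr0 pSv; apply.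
    by move=> t /dv[].
  move=> t t01; have dvt := dv _ t01; rewrite derive_val -scalerBr normrZ mulrC.
  have := pin k _ t01; rewrite addrA => /ad[_ /(_ k) Dk].
  by apply: ler_pM => //; exact: coord_le_mx_norm.
have pm : p m = h by apply/rowP => j; rewrite mxE ltn_ord.
have p0 : p 0%N = 0 by apply/rowP => j; rewrite !mxE ltn0.
have -> : f (a + h) - f a - mulmxr A h =
    \sum_(k < m) (f (a + p k.+1) - f (a + p k) - h ord0 k *: D k).
  rewrite big_split/= sumrN -AE; congr (_ - _).
  by rewrite -(big_mkord xpredT (fun k => f (a + p k.+1) - f (a + p k))) telescope_sumr//
    pm p0 addr0.
apply: le_trans (ler_norm_sum _ _ _) _.
apply: (@le_trans _ _ (\sum_(k < m) (e' * `|h|))); first by apply: ler_sum => k _.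
rewrite sumr_const card_ord -mulrnAl ler_wpM2r//.
have -> : e = e' *+ m.+1 by rewrite -mulr_natr divfK// pnatr_eq0.
by rewrite mulrS lerDr ltW.
Qed.

End continuously_differentiable.

(** * Derivatives along curves *)

Section curves.
Context (R : realType).

Lemma is_derive_comp_curve m n (u : R -> 'rV[R]_m) (f : 'rV[R]_m -> 'rV[R]_n) (t : R) :
  derivable u t 1 -> differentiable f (u t) ->
  is_derive t (1 : R) (f \o u) ('D_1 u t *m jacobian f (u t)).
Proof.
move=> du df; have dut : differentiable u t by apply/derivable1_diffP.
have dfu : differentiable (f \o u) t by apply: differentiable_comp.
apply: DeriveDef; first exact/derivable1_diffP.
by rewrite deriveE// diff_comp//= -deriveE// -deriveE// deriveEjacobian.
Qed.

Lemma derivable_continuous (V : normedModType R) (u : R -> V) (t : R) :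
  derivable u t 1 -> {for t, continuous u}.
Proof. by move/derivable1_diffP/differentiable_continuous. Qed.

Lemma cvg_growth_rate_right (V : normedModType R) (u : R -> V) (t : R) :
  derivable u t 1 ->
  (s - t)^-1 *: (u s - u t) @[s --> t^'+] --> 'D_1 u t.
Proof.
move=> du; have ht : s - t @[s --> t^'+] --> (0 : R)^'.
  move=> A /nbhs_ballP[e /= e0 eA]; apply/nbhs_ballP; exists e => // s.
  rewrite /ball/= distrC => ste ts; apply: eA; first by rewrite /ball/= sub0r normrN.
  by rewrite /= subr_eq0 gt_eqF.
have := cvg_comp _ _ ht du; apply: cvg_trans; apply: near_eq_cvg.
by near=> s; rewrite /= [_ *: (1 : R)]mulr1 subrK.
Unshelve. all: by end_near. Qed.

End curves.

(** * The Euclidean norm *)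

Section euclidean_norm.
Context (R : realType) (m : nat).
Implicit Types v w : 'rV[R]_m.

Definition enorm v := Num.sqrt (\sum_i v ord0 i ^+ 2).

Lemma enorm_ge0 v : 0 <= enorm v. Proof. exact: sqrtr_ge0. Qed.

Lemma enorm_sqr v : enorm v ^+ 2 = \sum_i v ord0 i ^+ 2.
Proof. by rewrite sqr_sqrtr// sumr_ge0// => i _; exact: sqr_ge0. Qed.

Lemma euclidean_ballE v (r : R) : euclidean_ball v r = [set w | enorm (w - v) < r].
Proof.
by rewrite /euclidean_ball /enorm; apply/funext => w /=; under [in RHS]eq_bigr do rewrite !mxE.
Qed.

Lemma enormZ (a : R) v : enorm (a *: v) = `|a| * enorm v.
Proof.
rewrite /enorm -sqrtr_sqr -sqrtrM ?sqr_ge0// mulr_sumr; congr Num.sqrt.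
by apply: eq_bigr => i _; rewrite mxE exprMn.
Qed.

Lemma enorm0 : enorm 0 = 0.
Proof. by rewrite -(scale0r (0 : 'rV[R]_m)) enormZ normr0 mul0r. Qed.

Lemma coord_le_enorm v i : `|v ord0 i| <= enorm v.
Proof.
rewrite -sqrtr_sqr ler_wsqrtr// (bigD1 i)//= lerDl sumr_ge0// => j _.
exact: sqr_ge0.
Qed.

Lemma mx_norm_le_enorm v : `|v| <= enorm v.
Proof.
apply: mx_norm_leP => [|i j]; first exact: enorm_ge0.
by rewrite (ord1 i); exact: coord_le_enorm.
Qed.

Lemma enorm_eq0 v : enorm v = 0 -> v = 0.
Proof.
by move=> v0; apply/eqP; rewrite -normr_le0 -v0 mx_norm_le_enorm.
Qed.

(** The Cauchy-Schwarz inequality, from the sum of the squares of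
[|w| v_i - |v| w_i]. *)
Lemma enorm_inner_le v w : \sum_i v ord0 i * w ord0 i <= enorm v * enorm w.
Proof.
have [/enorm_eq0->|v0] := eqVneq (enorm v) 0.
  by rewrite enorm0 mul0r big1// => i _; rewrite mxE mul0r.
have [/enorm_eq0->|w0] := eqVneq (enorm w) 0.
  by rewrite enorm0 mulr0 big1// => i _; rewrite mxE mulr0.
have vw0 : 0 < enorm v * enorm w by rewrite mulr_gt0// lt_def ?v0 ?w0 enorm_ge0.
have : 0 <= \sum_i (enorm w * v ord0 i - enorm v * w ord0 i) ^+ 2.
  by apply: sumr_ge0 => i _; exact: sqr_ge0.
have -> : \sum_i (enorm w * v ord0 i - enorm v * w ord0 i) ^+ 2 =
    enorm w ^+ 2 * \sum_i v ord0 i ^+ 2 + enorm v ^+ 2 * \sum_i w ord0 i ^+ 2 -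
    2 * (enorm v * enorm w) * \sum_i v ord0 i * w ord0 i.
  rewrite !mulr_sumr -big_split/= -sumrB; apply: eq_bigr => i _; ring.
rewrite -!enorm_sqr => h; rewrite -(ler_pM2l vw0); move: h.
set S := \sum_i _; set a := enorm v; set b := enorm w => h; lra.
Qed.

Lemma ler_enormD v w : enorm (v + w) <= enorm v + enorm w.
Proof.
rewrite -(@ler_pXn2r _ 2)// ?nnegrE ?addr_ge0 ?enorm_ge0//.
rewrite sqrrD !enorm_sqr.
have -> : \sum_i (v + w) ord0 i ^+ 2 = \sum_i v ord0 i ^+ 2 +
    2 * (\sum_i v ord0 i * w ord0 i) + \sum_i w ord0 i ^+ 2.
  by rewrite mulr_sumr -!big_split/=; apply: eq_bigr => i _; rewrite mxE; ring.
by rewrite lerD2r lerD2l -[leRHS]mulr_natl ler_pM2l ?enorm_inner_le.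
Qed.

Lemma cvg_enorm (T : Type) (F : set_system T) (f : T -> 'rV[R]_m) v :
  Filter F -> f x @[x --> F] --> v -> enorm (f x) @[x --> F] --> enorm v.
Proof.
move=> FF fv; rewrite /enorm.
apply: (@cvg_comp _ _ _ (fun x => \sum_i f x ord0 i ^+ 2) Num.sqrt _
  (nbhs (\sum_i v ord0 i ^+ 2))); last exact: sqrt_continuous.
apply: cvg_sum_seq => i _; rewrite expr2; under eq_fun do rewrite expr2.
by apply: cvgM; exact: cvg_coord.
Qed.

Lemma open_euclidean_ball v (r : R) : open (euclidean_ball v r).
Proof.
rewrite euclidean_ballE openE => w /= wr; rewrite /interior.
have : enorm (z - v) @[z --> w] --> enorm (w - v).
  apply: (@cvg_enorm _ (nbhs w) (fun z => z - v)).
  by apply: cvgB; [exact: cvg_id|exact: cvg_cst].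
by move=> /(_ [set x | x < r]); apply; exact: lt_nbhsl.
Qed.

End euclidean_norm.

(** The assumption beyond [0, 1] provides a primitive that has a two-sided
derivative at both endpoints. *)
Lemma continuous_primitive (R : realType) (f : R -> R) (e : R) : 0 < e ->
  (forall t, - e < t < 1 + e -> {for t, continuous f}) ->
  exists H : R -> R,
    (forall t, 0 <= t <= 1 -> derivable H t 1 /\ 'D_1 H t = f t) /\
    (\int[lebesgue_measure]_(t in `[0%R, 1%R]) (f t)%:E = (H 1 - H 0)%:E)%E.
Proof.
move=> e0 cf; pose a := - (e / 2); pose b := 1 + e / 2.
have fc (c d : R) : - e < c -> d < 1 + e -> {within `[c, d], continuous f}.
  move=> ec de; apply: continuous_in_subspaceT => t; rewrite inE/= in_itv/= => /andP[ct td].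
  by apply: cf; rewrite (lt_le_trans ec ct) (le_lt_trans td de).
have fi : lebesgue_measure.-integrable `[a, b] (EFin \o f).
  apply: continuous_compact_integrable; first exact: segment_compact.
  by apply: fc; rewrite /a /b; lra.
(* The base point [a] is negative, so that 0 is interior to the domain. *)
pose H x := (\int[lebesgue_measure]_(t in `[a, x]) f t)%R.
have dH t : 0 <= t <= 1 -> derivable H t 1 /\ 'D_1 H t = f t.
  move=> /andP[t0 t1]; rewrite -derive1E.
  apply: (continuous_FTC1_closed (u := b)) fi _ _; rewrite /a /b.
  - lra.
  - lra.
  - by apply: cf; lra.
exists H; split => //; rewrite EFinB.
apply: continuous_FTC2 => //; [by apply: fc; lra| |].
- split => [t||]; first by rewrite in_itv/= => /andP[t0 t1]; apply: (dH t _).1; rewrite !ltW.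
    by apply: cvg_at_right_filter; apply/derivable_continuous/(dH 0 _).1; rewrite lexx ler01.
  by apply: cvg_at_left_filter; apply/derivable_continuous/(dH 1 _).1; rewrite lexx ler01.
- move=> t; rewrite in_itv/= => /andP[t0 t1].
  by rewrite derive1E; apply: (dH t _).2; rewrite !ltW.
Qed.

(** * Charts and the speed of curves *)

Section charts_and_speed.
Context (R : realType) (m : nat) (M : manifold R m).
Implicit Types (c d : chart R m M) (p q : M) (s : R -> M).

Lemma chart_open c : atlas c -> open (dom c).
Proof. by move=> /atlas_chart[[]]. Qed.

Lemma chart_image_open c : atlas c -> open (chart_image c).
Proof. by move=> /atlas_chart[[]]. Qed.

Lemma chart_fwdK c p : atlas c -> dom c p -> bwd c (fwd c p) = p.
Proof. by move=> /atlas_chart[_ + _ _ _]; apply. Qed.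

Lemma chart_dom_bwd c y : atlas c -> chart_image c y -> dom c (bwd c y).
Proof. by move=> ac [p cp <-]; rewrite chart_fwdK. Qed.

Lemma chart_bwdK c y : atlas c -> chart_image c y -> fwd c (bwd c y) = y.
Proof. by move=> ac [p cp <-]; rewrite chart_fwdK. Qed.

Lemma chart_near_dom c p : atlas c -> dom c p -> \forall q \near p, dom c q.
Proof. by move=> ac cp; apply: open_nbhs_nbhs; split => //; exact: chart_open. Qed.

Lemma chart_fwd_continuous c p : atlas c -> dom c p -> {for p, continuous (fwd c)}.
Proof. by move=> /atlas_chart[_ _ + _ _]; apply. Qed.

Lemma chart_bwd_continuous c y : atlas c -> chart_image c y -> {for y, continuous (bwd c)}.
Proof. by move=> /atlas_chart[_ _ _ + _]; apply. Qed.

(** The set is the image of [K] under the inverse chart, hence compact, hence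
closed since [M] is Hausdorff. So a curve cannot leave the chart while its
coordinates stay in [K]. *)
Lemma closed_chart_preimage c (K : set 'rV[R]_m) : atlas c -> compact K ->
  K `<=` chart_image c -> closed [set p | dom c p /\ K (fwd c p)].
Proof.
move=> ac cK Kc; have -> : [set p | dom c p /\ K (fwd c p)] = bwd c @` K.
  apply/seteqP; split => [p [cp Kp]|_ [y Ky <-]].
    by exists (fwd c p) => //; rewrite chart_fwdK.
  have cy := Kc _ Ky; split; first exact: chart_dom_bwd.
  by rewrite chart_bwdK.
apply: compact_closed; first exact: manifold_hausdorff.
apply: continuous_compact => //; apply: continuous_in_subspaceT => y.
by rewrite inE => /Kc; exact: chart_bwd_continuous.
Qed.

Lemma overlap_nbhs c d p : atlas c -> atlas d -> dom c p -> dom d p ->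
  nbhs (fwd c p) (overlap c d).
Proof.
move=> ac ad cp dp; have cy : chart_image c (fwd c p) by exists p.
have near_d : \forall y \near fwd c p, dom d (bwd c y).
  by apply: (chart_bwd_continuous ac cy); rewrite chart_fwdK//; exact: chart_near_dom.
have near_c : \forall y \near fwd c p, chart_image c y.
  by apply: open_nbhs_nbhs; split => //; exact: chart_image_open.
apply: filterS2 near_d near_c => y dy ciy; exists (bwd c y); last exact: chart_bwdK.
by split => //; exact: chart_dom_bwd.
Qed.

Lemma transition_differentiable c d p : atlas c -> atlas d ->
  dom c p -> dom d p -> differentiable (transition c d) (fwd c p).
Proof.
move=> ac ad cp dp; apply: C1_differentiable (overlap_nbhs ac ad cp dp) _.
exact: atlas_smooth.
Qed.

Lemma chart_atP p : atlas (chart_at p) /\ dom (chart_at p) p.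
Proof. exact: projT2 (cid (atlas_cover p)). Qed.

Lemma is_derive_chart_change s t c d : atlas c -> atlas d ->
  {for t, continuous s} -> dom c (s t) -> dom d (s t) ->
  derivable (fwd c \o s : R -> 'rV[R]_m) t 1 ->
  is_derive t (1 : R) (fwd d \o s : R -> 'rV[R]_m)
    ('D_1 (fwd c \o s : R -> 'rV[R]_m) t *m
     jacobian (transition c d) (fwd c (s t))).
Proof.
move=> ac ad cs cst dst du.
have := is_derive_comp_curve du (transition_differentiable ac ad cst dst).
apply: near_eq_is_derive.
have := cs _ (chart_near_dom ac cst); rewrite /= => near_c.
near=> r; have cr : dom c (s r) by near: r.
by rewrite /transition/= chart_fwdK.
Unshelve. all: by end_near. Qed.

Variable g : riemannian_metric M.

Definition gnorm c (y v : 'rV[R]_m) := Num.sqrt ((v *m g c y *m v^T) ord0 ord0).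

(** The definition of the speed at [t] refers to the chart chosen at the point
[s t], which varies with [t]. The transformation law of the Gram matrices
compensates the Jacobian of the change of charts, so one fixed chart will do. *)
Lemma speedE s t c : atlas c -> dom c (s t) -> {for t, continuous s} ->
  derivable (fwd c \o s : R -> 'rV[R]_m) t 1 ->
  speed g s t = gnorm c (fwd c (s t)) ('D_1 (fwd c \o s : R -> 'rV[R]_m) t).
Proof.
move=> ac cst cs du; have [ad dst] := chart_atP (s t).
have [_ dE] := is_derive_chart_change ac ad cs cst dst du.
rewrite /speed /gnorm /velocity /gram_at derive1E dE.
by rewrite (gram_transition g ac ad cst dst) trmx_mul !mulmxA.
Qed.

Lemma cvg_gnorm (T : Type) (F : set_system T) (u v : T -> 'rV[R]_m) c y w :
  Filter F -> atlas c -> chart_image c y ->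
  u x @[x --> F] --> y -> v x @[x --> F] --> w ->
  gnorm c (u x) (v x) @[x --> F] --> gnorm c y w.
Proof.
move=> FF ac cy uy vw.
apply: (@cvg_comp _ _ _ (fun x => (v x *m g c (u x) *m (v x)^T) ord0 ord0) Num.sqrt _
  (nbhs ((w *m g c y *m w^T) ord0 ord0))); last exact: sqrt_continuous.
apply: cvg_coord; apply: cvg_mulmx; last exact: cvg_trmx.
apply: cvg_mulmx => //.
apply: (cvg_comp _ _ uy).
by have [+ _] := gram_smooth g ac 0; apply.
Qed.

Lemma Ck1_curve_derivable (I : set R) s t c : Ck_curve 1 I s -> I t ->
  atlas c -> dom c (s t) -> derivable (fwd c \o s : R -> 'rV[R]_m) t 1.
Proof. by move=> [_ /(_ c) sc] It /sc[_ /(_ 1)[+ _]] cst; apply; split. Qed.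

(** By [speedE], the speed near a given time is a continuous expression in one
fixed chart. *)
Lemma speed_continuous (I : set R) s t : Ck_curve 1 I s -> open I -> I t ->
  {for t, continuous (speed g s)}.
Proof.
move=> sC1 oI It; have [ac cst] := chart_atP (s t); set c := chart_at (s t) in ac cst.
have cs r : I r -> {for r, continuous s} by move=> Ir; apply: sC1.1.
have [_ /(_ 1)[_ [+ _]]] := sC1.2 c ac.
move=> /(_ t (conj It cst)) cdu.
have ct : speed g s t = gnorm c (fwd c (s t)) ('D_1 (fwd c \o s : R -> 'rV[R]_m) t).
  exact: (speedE ac cst (cs t It) (Ck1_curve_derivable sC1 It ac cst)).
rewrite /prop_for /continuous_at ct.
have near_I : \forall r \near t, I r by apply: open_nbhs_nbhs; split.
have near_c := cs t It _ (chart_near_dom ac cst).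
pose u : R -> 'rV[R]_m := fwd c \o s.
have cu : u r @[r --> t] --> fwd c (s t).
  exact: (cvg_comp _ _ (cs t It) (chart_fwd_continuous ac cst)).
have cy : chart_image c (fwd c (s t)) by exists (s t).
have h := @cvg_gnorm _ (nbhs t) u ('D_1 u) c _ _ _ ac cy cu cdu.
move=> A /h hA; apply: filterS3 near_I near_c hA => r Ir cr.
rewrite /=.
by rewrite (speedE ac cr (cs r Ir) (Ck1_curve_derivable sC1 Ir ac cr)).
Qed.

End charts_and_speed.

(** * Lower bound for the Riemannian distance *)

Section length_lower_bound.
Context (R : realType) (m : nat) (M : manifold R m) (g : riemannian_metric M).
Context (c : chart R m M) (k delta : R).
Hypothesis ac : atlas c.
Hypothesis k0 : 0 < k.
Hypothesis ball_image : forall y, enorm y < delta -> chart_image c y.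
Hypothesis gnorm_ge : forall y v, enorm y < delta -> k * enorm v <= gnorm g c y v.

Definition near_center (p : M) := dom c p /\ enorm (fwd c p) < delta.

(** Clipped at [delta], the Euclidean distance to the center of the chart becomes
a function on all of [M], which can be followed along arbitrary curves, even
when they leave the chart. *)
Definition chart_radius (p : M) : R :=
  if `[< near_center p >] then enorm (fwd c p) else delta.

Lemma chart_radius_in p : near_center p -> chart_radius p = enorm (fwd c p).
Proof. by rewrite /chart_radius => /asboolT ->. Qed.

Lemma chart_radius_out p : ~ near_center p -> chart_radius p = delta.
Proof. by rewrite /chart_radius => /asboolF ->. Qed.

Lemma chart_radius_le p : chart_radius p <= delta.
Proof.
by have [/[dup] pc /chart_radius_in->|/chart_radius_out->//] :=
  pselect (near_center p); apply/ltW/pc.2.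
Qed.

Lemma near_centerP p : chart_radius p < delta -> near_center p.
Proof. by move=> pd; apply: contrapT => /chart_radius_out pE; rewrite pE ltxx in pd. Qed.

Lemma cvg_enorm_fwd p : dom c p -> enorm (fwd c q) @[q --> p] --> enorm (fwd c p).
Proof. by move=> cp; apply: cvg_enorm; exact: chart_fwd_continuous. Qed.

Lemma closed_chart_ball (rho : R) : rho < delta ->
  closed [set p | dom c p /\ enorm (fwd c p) <= rho].
Proof.
move=> rd; apply: (@closed_chart_preimage _ _ _ c [set y | enorm y <= rho]) => //.
  apply: bounded_closed_compact.
    exists rho; split; first exact: num_real.
    move=> a ra y /= yr; apply: le_trans (mx_norm_le_enorm y) _.
    by rewrite (le_trans yr)// ltW.
  apply: (@closed_comp _ _ (@enorm R m) [set x | x <= rho]); last exact: closed_le.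
  by move=> y _; exact: (@cvg_enorm R m _ (nbhs y) id y _ cvg_id).
by move=> y /= yr; apply: ball_image; exact: le_lt_trans rd.
Qed.

(** At a point far from the center this expresses that the preimages of the closed
balls of radius less than [delta] are closed in [M]. *)
Lemma chart_radius_lsc p (e : R) : 0 < e ->
  \forall q \near p, chart_radius p <= chart_radius q + e.
Proof.
move=> e0; have [pc|pc] := pselect (near_center p).
  rewrite chart_radius_in//.
  have near_c := chart_near_dom ac pc.1.
  have /cvgrPdist_lt/(_ e e0) near_e := cvg_enorm_fwd pc.1.
  apply: filterS2 near_c near_e => q cq qe.
  have [qc|qc] := pselect (near_center q).
    by rewrite chart_radius_in//; move: qe; rewrite ltr_norml; lra.
  by rewrite chart_radius_out//; have := pc.2; lra.
rewrite chart_radius_out//; have de : delta - e < delta by lra.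
have /closed_openC oC := closed_chart_ball de.
have : nbhs p (~` [set q | dom c q /\ enorm (fwd c q) <= delta - e]).
  apply: open_nbhs_nbhs; split => //= -[cp ple]; apply: pc; split => //.
  exact: le_lt_trans de.
apply: filterS => q /= qc; have [qn|qn] := pselect (near_center q).
  rewrite chart_radius_in//; rewrite leNgt; apply/negP => qe; apply: qc.
  by split; [exact: qn.1|lra].
by rewrite chart_radius_out// lerDl ltW.
Qed.

(** The function [k * chart_radius (s t)] minus the length covered until [t]
satisfies the increment estimates of [nonincreasing_endpoints]: inside the ball
because [k * |u'|] is at most the speed, and on the rest of [M] because the
clipped radius has its maximal value there. *)
Lemma length_ge_chart_radius (s : R -> M) (e : R) : 0 < e ->
  Ck_curve 1 `](- e), (1 + e)[ s ->
  ((k * (chart_radius (s 1) - chart_radius (s 0)))%:E <=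
   \int[lebesgue_measure]_(t in `[0%R, 1%R]) (speed g s t)%:E)%E.
Proof.
move=> e0 sC1.
have oI : open (`](- e), (1 + e)[%classic : set R) by exact: interval_open.
have inI (t : R) : 0 <= t <= 1 -> `](- e), (1 + e)[%classic t.
  by move=> /andP[t0 t1]; rewrite /= in_itv/=; lra.
have [|H [dH ->]] := @continuous_primitive R (speed g s) e e0.
  by move=> t te; apply: (@speed_continuous _ _ _ g _ s t sC1 oI); rewrite /= in_itv/=.
rewrite lee_fin.
pose psi t := k * chart_radius (s t) - H t.
suff : psi 1 <= psi 0 by rewrite /psi; lra.
have cs (t : R) : 0 <= t <= 1 -> {for t, continuous s} by move=> /inI; apply: sC1.1.
apply: nonincreasing_endpoints => t a.
  move=> t01 a0; have t01' : 0 <= t <= 1 by case/andP: t01 => t0 ->; rewrite ltW.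
  have a20 : 0 < a / 2 by lra.
  have cH : {for t, continuous H} by apply: derivable_continuous; exact: (dH t t01').1.
  have near_H : \forall r \near t, `|H t - H r| < a / 2.
    by move/cvgrPdist_lt : cH => /(_ _ a20).
  have ak0 : 0 < a / 2 / k by rewrite divr_gt0.
  have near_r := cs t t01' _ (chart_radius_lsc (s t) ak0).
  suff : \forall r \near t, psi t <= psi r + a by exact: cvg_within.
  apply: filterS2 near_H near_r => r Hr /= rr.
  have : k * chart_radius (s t) <= k * (chart_radius (s r) + a / 2 / k).
    by rewrite ler_pM2l.
  rewrite mulrDr [k * (_ / k)]mulrCA divff ?gt_eqF// mulr1.
  by move: Hr; rewrite /psi ltr_norml; lra.
move=> t01 a0; have t01' : 0 <= t <= 1 by case/andP: t01 => -> t1; rewrite ltW.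
have a20 : 0 < a / 2 by lra.
have near_H : \forall r \near t^'+, H t - H r <= (a / 2 - speed g s t) * (r - t).
  have [dHt dHE] := dH t t01'.
  have /cvgrPdist_le/(_ _ a20) := cvg_growth_rate_right dHt; rewrite dHE => near_d.
  near=> r; have rt : t < r by near: r; exact: nbhs_right_gt.
  have : `|speed g s t - (r - t)^-1 *: (H r - H t)| <= a / 2 by near: r.
  rewrite ler_norml => /andP[_]; rewrite lerBlDr -lerBlDl.
  rewrite [_ *: _]mulrC ler_pdivlMr ?subr_gt0//; lra.
have [tc|tc] := pselect (near_center (s t)); last first.
  near=> r; have rt : t < r by near: r; exact: nbhs_right_gt.
  have Hr : H t - H r <= (a / 2 - speed g s t) * (r - t) by near: r.
  have := chart_radius_le (s r); rewrite -(chart_radius_out tc).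
  rewrite -(ler_pM2l k0) => rr.
  have : 0 <= speed g s t * (r - t) by rewrite mulr_ge0 ?sqrtr_ge0// subr_ge0 ltW.
  have : 0 < a * (r - t) by rewrite mulr_gt0 ?subr_gt0.
  rewrite /psi; lra.
set u : R -> 'rV[R]_m := fwd c \o s.
have du : derivable u t 1 by exact: Ck1_curve_derivable sC1 (inI _ t01') ac tc.1.
(* Inside the ball, where the coordinates [u] of the curve are differentiable. *)
have sp : k * enorm ('D_1 u t) <= speed g s t.
  by rewrite (speedE g ac tc.1 (cs _ t01') du); apply: gnorm_ge; exact: tc.2.
have near_u : \forall r \near t^'+, k * enorm (u r - u t) <= (speed g s t + a / 2) * (r - t).
  have /cvgrPdist_le/(_ (a / 2 / k)) :=
    @cvg_enorm _ _ _ _ _ _ (at_right_proper_filter t) (cvg_growth_rate_right du).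
  rewrite divr_gt0// => /(_ isT) near_d.
  near=> r; have rt : t < r by near: r; exact: nbhs_right_gt.
  have : `|enorm ('D_1 u t) - enorm ((r - t)^-1 *: (u r - u t))| <= a / 2 / k by near: r.
  rewrite enormZ (ger0_norm (_ : 0 <= (r - t)^-1)); last by rewrite invr_ge0 subr_ge0 ltW.
  rewrite ler_norml => /andP[hr _].
  have {hr} : enorm (u r - u t) / (r - t) <= enorm ('D_1 u t) + a / 2 / k by lra.
  rewrite ler_pdivrMr ?subr_gt0// -(ler_pM2l k0) => /le_trans; apply.
  rewrite mulrA ler_pM2r ?subr_gt0// mulrDr [k * (_ / k)]mulrCA divff ?gt_eqF// mulr1.
  by rewrite lerD2r.
have near_c : \forall r \near t^'+, dom c (s r).
  have near_c : \forall r \near t, dom c (s r).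
    exact: (cs _ t01' _ (chart_near_dom ac tc.1)).
  exact: cvg_within near_c.
near=> r; have rt : t < r by near: r; exact: nbhs_right_gt.
have Hr : H t - H r <= (a / 2 - speed g s t) * (r - t) by near: r.
have ur : k * enorm (u r - u t) <= (speed g s t + a / 2) * (r - t) by near: r.
have cr : dom c (s r) by near: r.
have rr : chart_radius (s r) <= enorm (u t) + enorm (u r - u t).
  apply: le_trans (ler_enormD _ _); rewrite addrC subrK.
  have [rc|rc] := pselect (near_center (s r)); first by rewrite chart_radius_in.
  rewrite chart_radius_out// leNgt; apply/negP => ud; exact: rc.
rewrite -(ler_pM2l k0) mulrDr in rr.
rewrite /psi [chart_radius (s t)]chart_radius_in//; rewrite -/(u t) in rr *.
move: rr ur Hr; rewrite !mulrBl !mulrDl; rewrite /u/=; lra.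
Unshelve. all: by end_near. Qed.

Lemma riemannian_dist_ge_chart_radius p q :
  ((k * (chart_radius q - chart_radius p))%:E <= riemannian_dist g p q)%E.
Proof.
apply: le_ereal_inf_tmp => _ [ss pss <-].
elim: ss p pss => [p /= ->|s ss IH p [[e e0 sC1] s0 pss]].
  by rewrite /curve_length big_nil subrr mulr0.
rewrite /curve_length big_cons -/(curve_length g ss).
have := leeD (length_ge_chart_radius e0 sC1) (IH _ pss).
by apply: le_trans; rewrite -EFinD lee_fin s0 -mulrDr ler_pM2l//; lra.
Qed.

End length_lower_bound.

(** * Upper bound for the Riemannian distance *)

Section segments.
Context (R : realType) (m : nat) (M : manifold R m) (g : riemannian_metric M).
Implicit Types (c d : chart R m M) (p q : M) (a h : 'rV[R]_m).

Definition segment c a h : R -> M := fun t => bwd c (a + t *: h).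

Lemma line_continuous a h (t : R) : (a + r *: h) @[r --> t] --> a + t *: h.
Proof.
have := @is_derive_line R _ _ id a h t (@derivable_id _ _ _ _).
by move=> [dl _]; exact: derivable_continuous dl.
Qed.

Lemma segment_continuous c a h t : atlas c -> chart_image c (a + t *: h) ->
  {for t, continuous (segment c a h)}.
Proof.
move=> ac cy A /(chart_bwd_continuous ac cy) hA.
exact: (@line_continuous a h t (bwd c @^-1` A) hA).
Qed.

(** In another chart the segment is the transition map restricted to a line, whose
derivative is a directional derivative of the transition map. *)
Lemma segment_C1 c a h (J : set R) : open J -> atlas c ->
  (forall t, J t -> chart_image c (a + t *: h)) ->
  Ck_curve 1 J (segment c a h).
Proof.
move=> oI ac Ic; have cs t : J t -> {for t, continuous (segment c a h)}.
  by move=> /Ic; exact: segment_continuous.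
split; first by move=> t It; exact: cs.
move=> d ad; pose T := transition c d.
set O := _ `&` _; have OT t : O t -> overlap c d (a + t *: h).
  move=> [It dt]; exists (segment c a h t); last by rewrite chart_bwdK//; exact: Ic.
  by split => //; apply: chart_dom_bwd => //; exact: Ic.
have [cT dT] := atlas_smooth ac ad 1%N.
have dl t : O t -> is_derive t (1 : R) (fun r => T (a + r *: h)) ('D_h T (a + t *: h)).
  by move=> /OT oT; apply: is_derive_line; exact: (dT h).1.
have dv t (v : R) : O t ->
    is_derive t v (fun r => T (a + r *: h)) (v *: 'D_h T (a + t *: h)).
  move=> /dl[dlt <-]; rewrite -{1}[v]mulr1.
  exact: (is_derive_scale_dir v dlt).
split=> [t /dl[dlt _]|v]; first exact: derivable_continuous dlt.
split; first by move=> t Ot; have [] := dv t v Ot.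
split; last exact: I.
move=> t Ot.
have near_I : \forall r \near t, J r by apply: open_nbhs_nbhs; split => //; exact: Ot.1.
have near_d := cs t Ot.1 _ (chart_near_dom ad Ot.2).
have cD : v *: 'D_h T (a + r *: h) @[r --> t] --> v *: 'D_h T (a + t *: h).
  apply: cvgZ; first exact: cvg_cst.
  by move=> A /((dT h).2.1 _ (OT t Ot)) hA; exact: (@line_continuous a h t ('D_h T @^-1` A) hA).
have [_ Dt] := dv t v Ot; rewrite /prop_for /continuous_at Dt.
move=> A /cD hA; apply: filterS3 near_I near_d hA => r Ir dr.
by have [_ Dr] := dv r v (conj Ir dr); rewrite /preimage /= -Dr.
Qed.

Lemma speed_segment c a h t : atlas c -> chart_image c (a + t *: h) ->
  speed g (segment c a h) t = gnorm g c (a + t *: h) h.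
Proof.
move=> ac cy; have cs := segment_continuous ac cy.
have near_y : \forall r \near t, chart_image c (a + r *: h).
  apply: (@line_continuous a h t).
  by apply: open_nbhs_nbhs; split => //; exact: chart_image_open.
have [dl dlE] : is_derive t (1 : R) (fwd c \o segment c a h : R -> 'rV[R]_m) h.
  have := @is_derive_line R _ _ id a h t (@derivable_id _ _ _ _).
  rewrite derive_id; apply: near_eq_is_derive.
  by apply: filterS near_y => r cr; rewrite /segment/= chart_bwdK.
rewrite (speedE g ac _ cs dl); last exact: chart_dom_bwd.
by rewrite dlE /segment chart_bwdK.
Qed.

Lemma riemannian_dist_segment_le p c a h (e K : R) : 0 < e -> atlas c ->
  (forall t, - e < t < 1 + e -> chart_image c (a + t *: h)) ->
  (forall t, 0 <= t <= 1 -> gnorm g c (a + t *: h) h <= K) ->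
  (riemannian_dist g p (bwd c (a + h)) <= riemannian_dist g p (bwd c a) + K%:E)%E.
Proof.
move=> e0 ac Ic hK; rewrite -leeBlDr//.
apply: le_ereal_inf_tmp => _ [ss pss <-]; rewrite leeBlDr//.
have sC1 : Ck_curve 1 `](- e), (1 + e)[ (segment c a h).
  by apply: segment_C1.
apply: (@le_trans _ _ (curve_length g (rcons ss (segment c a h)))).
  apply: ereal_inf_lbound; exists (rcons ss (segment c a h)) => //=.
  elim: ss p pss => [p /= ->|s ss IH p [C1s s0 pss]].
    by split; [exists e|rewrite /segment scale0r addr0|rewrite /segment scale1r].
  by split => //; exact: IH.
rewrite /curve_length -cats1 big_cat big_seq1 leeD2l//.
have -> : (K%:E = \int[lebesgue_measure]_(t in `[0%R, 1%R]) (cst K%:E t))%E.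
  rewrite integral_cst//= lebesgue_measure_itv/= lte_fin ltr01.
  by rewrite oppr0 adde0 mule1.
apply: le_integral_nonneg => t; rewrite /= in_itv/= => t01.
rewrite !lee_fin sqrtr_ge0 speed_segment ?hK//.
by apply: Ic; case/andP: t01; lra.
Qed.

Lemma riemannian_dist_refl p : riemannian_dist g p p = 0%E.
Proof.
apply/eqP; rewrite eq_le; apply/andP; split.
  by apply: ereal_inf_lbound; exists [::] => //; rewrite /curve_length big_nil.
apply: le_ereal_inf_tmp => _ [ss _ <-]; apply: sume_ge0 => s _.
by apply: integral_ge0 => t _; rewrite lee_fin sqrtr_ge0.
Qed.

(** In a chart at [q], short segments issued from [q] are short for the metric
as well, so points near [q] can be reached from the center of the ball at
little additional cost. *)
Lemma riemannian_ball_open p (r : R) : open (riemannian_ball g p r).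
Proof.
rewrite openE => q qr; rewrite /interior.
have [ac cq] := chart_atP q; set c := chart_at q in ac cq; set a := fwd c q.
have qE : q = bwd c a by rewrite chart_fwdK.
have [eps eps0 eps_le] : exists2 eps : R, 0 < eps &
    (riemannian_dist g p q + eps%:E < r%:E)%E.
  move: qr; rewrite /riemannian_ball/=; case: (riemannian_dist g p q) => [x|//|_].
    rewrite lte_fin => xr; exists ((r - x) / 2); first lra.
    by rewrite -EFinD lte_fin; lra.
  by exists 1; [exact: ltr01|rewrite addNye ltNyr].
have cy : chart_image c a by exists q.
pose gn (z : 'rV[R]_m * 'rV[R]_m) := gnorm g c z.1 z.2.
have gn0 : gn z @[z --> (a, 0 : 'rV[R]_m)] --> 0.
  have -> : 0 = gnorm g c a 0 by rewrite /gnorm !mul0mx mxE sqrtr0.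
  by apply: cvg_gnorm => //; [exact: cvg_fst|exact: cvg_snd].
have : \forall z \near (a, 0 : 'rV[R]_m), chart_image c z.1 /\ gn z < eps.
  apply: filterI.
    have := @cvg_fst _ _ (nbhs a) (nbhs (0 : 'rV[R]_m)) _ (chart_image c); apply.
    by apply: open_nbhs_nbhs; split => //; exact: chart_image_open.
  move/cvgr0Pnorm_lt : gn0 => /(_ _ eps0); apply: filterS => z.
  by rewrite ger0_norm ?sqrtr_ge0.
move=> /nbhs_ballP[d /= d0 ad].
have adE z v : `|z - a| < d -> `|v| < d -> chart_image c z /\ gnorm g c z v < eps.
  move=> zd vd; apply: (ad (z, v)); split => /=.
    by rewrite -ball_normE/= distrC.
  by rewrite -ball_normE/= sub0r normrN.
have near_d : \forall q' \near q, dom c q' /\ `|fwd c q' - a| < d / 2.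
  apply: filterI; first exact: chart_near_dom.
  have d20 : 0 < d / 2 by lra.
  have := chart_fwd_continuous ac cq => /cvgrPdist_lt/(_ _ d20).
  by apply: filterS => q'; rewrite distrC.
apply: filterS near_d => q' [cq' q'd]; apply: le_lt_trans eps_le.
set h := fwd c q' - a in q'd.
have -> : q' = bwd c (a + h) by rewrite addrC subrK chart_fwdK.
rewrite [X in (_ <= riemannian_dist _ _ X + _)%E]qE.
apply: (riemannian_dist_segment_le _ ltr01) => // t tt.
  apply: (adE _ 0 _ _).1; last by rewrite normr0.
  rewrite addrAC subrr add0r normrZ.
  have : `|t| <= 2 by rewrite ler_norml; lra.
  move=> t2; apply: (@le_lt_trans _ _ (2 * `|h|)); first by rewrite ler_wpM2r.
  lra.
apply/ltW/(adE _ _ _ _).2; last by have := normr_ge0 h; lra.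
rewrite addrAC subrr add0r normrZ.
have : `|t| <= 1 by rewrite ler_norml; lra.
move=> t2; apply: (@le_lt_trans _ _ (1 * `|h|)); first by rewrite ler_wpM2r.
have := normr_ge0 h; lra.
Qed.

(** The segment from the origin to [y] is still inside the ball when extended a
little beyond both ends, as curves have to be. *)
Lemma riemannian_dist_center_le c (K delta : R) x y : atlas c -> dom c x ->
  fwd c x = 0 -> 0 <= K ->
  (forall y, enorm y < delta -> chart_image c y) ->
  (forall y v, enorm y < delta -> gnorm g c y v <= K * enorm v) ->
  enorm y < delta ->
  (riemannian_dist g x (bwd c y) <= (K * enorm y)%:E)%E.
Proof.
move=> ac cx x0 K0 ball_image gnorm_le yd; pose n := enorm y.
have n0 : 0 <= n by exact: enorm_ge0.
(* Chosen such that [(1 + e) * n < delta]. *)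
pose e := (delta - n) / (n + 1).
have e0 : 0 < e by rewrite divr_gt0 ?subr_gt0//; lra.
have en : e * n < delta - n.
  rewrite /e mulrAC ltr_pdivrMr; last lra.
  by rewrite ltr_pM2l ?subr_gt0//; lra.
have td (t : R) : - e < t < 1 + e -> enorm (0 + t *: y) < delta.
  move=> te; rewrite add0r enormZ; apply: (@le_lt_trans _ _ ((1 + e) * n)).
    by rewrite ler_wpM2r// ler_norml; lra.
  by rewrite mulrDl mul1r; lra.
have := @riemannian_dist_segment_le x c 0 y e (K * n) e0 ac _ _.
rewrite add0r -x0 chart_fwdK// riemannian_dist_refl add0e x0; apply.
  by move=> t /td; exact: ball_image.
move=> t t01; apply: gnorm_le; apply: td; case/andP: t01; lra.
Qed.

Lemma open_manifold_measurable (U : set M) : open U -> manifold_measurable U.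
Proof.
move=> oU c ac; apply: open_measurable_rV; rewrite openE => _ [p [Up cp] <-].
have cy : chart_image c (fwd c p) by exists p.
have near_U : \forall y \near fwd c p, U (bwd c y).
  apply: (chart_bwd_continuous ac cy); rewrite chart_fwdK//.
  by apply: open_nbhs_nbhs; split.
have near_c : \forall y \near fwd c p, chart_image c y.
  by apply: open_nbhs_nbhs; split => //; exact: chart_image_open.
apply: filterS2 near_U near_c => y Uy ciy; exists (bwd c y); last exact: chart_bwdK.
by split => //; exact: chart_dom_bwd.
Qed.

Lemma fwd_imageI c (A B : set M) : atlas c ->
  fwd c @` ((A `&` B) `&` dom c) =
  (fwd c @` (A `&` dom c)) `&` (fwd c @` (B `&` dom c)).
Proof.
move=> ac; apply/seteqP; split => [_ [p [[Ap Bp] cp] <-]|_ [[p [Ap cp] <-] [q [Bq cq] qp]]].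
  by split; exists p.
exists p => //; split => //; split => //.
by rewrite -(chart_fwdK ac cp) -qp chart_fwdK.
Qed.

Lemma manifold_measurableI (A B : set M) :
  manifold_measurable A -> manifold_measurable B -> manifold_measurable (A `&` B).
Proof.
by move=> mA mB c ac; rewrite fwd_imageI//; apply: measurableI; [exact: mA|exact: mB].
Qed.

End segments.

(** * Geodesics with small initial velocity *)

Section christoffel_bound.
Context (R : realType) (m : nat) (M : manifold R m) (g : riemannian_metric M).
Implicit Types (c d : chart R m M).

Lemma gram_unit c y : atlas c -> chart_image c y -> g c y \in unitmx.
Proof.
move=> ac cy; rewrite -row_free_unit -kermx_eq0; apply: contraT => K0.
have v0 : nz_row (kermx (g c y)) != 0 by rewrite nz_row_eq0.
have := gram_posdef g ac cy v0.
have /sub_kermxP -> : (nz_row (kermx (g c y)) <= kermx (g c y))%MS by exact: nz_row_sub.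
by rewrite mul0mx mxE ltxx.
Qed.

(** The Christoffel symbols are continuous, being built from the Gram matrix, its
inverse and its first derivatives. *)
Lemma christoffel_bounded_near c y k i j : atlas c -> chart_image c y ->
  exists C : R, \forall z \near y, `|christoffel g c z k i j| <= C.
Proof.
move=> ac cy.
have near_c : \forall z \near y, chart_image c z.
  by apply: open_nbhs_nbhs; split => //; exact: chart_image_open.
have [cg dg] := gram_smooth g ac 1.
pose D (a b e : 'I_m) z := ('D_(delta_mx ord0 a : 'rV[R]_m) (g c) z) b e.
have cD a b e : D a b e z @[z --> y] --> D a b e y.
  apply: cvg_coord; exact: (dg (delta_mx ord0 a)).2.1.
pose G z : R := 2^-1 * \sum_l invmx (g c z) k l * (D i j l z + D j i l z - D l i j z).
have FF : Filter (nbhs y) := nbhs_filter y.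
have cG : G z @[z --> y] --> G y.
  apply: cvgM; first exact: cvg_cst.
  apply: cvg_sum_seq => l _; apply: cvgM.
    by apply: cvg_coord; apply: cvg_invmx; [exact: gram_unit|exact: cg].
  by apply: cvgB => //; apply: cvgD.
exists (`|G y| + 1).
have /cvgrPdist_lt/(_ _ ltr01) near_G := cG.
apply: filterS2 near_c near_G => z cz Gz.
have -> : christoffel g c z k i j = G z.
  rewrite /christoffel /G; congr (_ * _); apply: eq_bigr => l _.
  have DE a b e : 'D_(delta_mx ord0 a : 'rV[R]_m) (fun z' => g c z' b e) z = D a b e z.
    by rewrite /D derive_mx ?mxE//; exact: (dg (delta_mx ord0 a)).1.
  by rewrite !DE.
rewrite -lerBlDl; apply: le_trans (lerB_dist _ _) _.
by rewrite distrC ltW.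
Qed.

Lemma christoffel_quadratic_bound c y : atlas c -> chart_image c y ->
  exists2 C : R, 0 <= C & \forall z \near y, forall (w : 'rV[R]_m) k,
    `|\sum_i \sum_j christoffel g c z k i j * w ord0 i * w ord0 j| <= C * `|w| ^+ 2.
Proof.
move=> ac cy.
have [C HC] : {C : 'I_m * ('I_m * 'I_m) -> R & forall kij,
    \forall z \near y, `|christoffel g c z kij.1 kij.2.1 kij.2.2| <= C kij}.
  apply: (@choice _ _ (fun kij C =>
    \forall z \near y, `|christoffel g c z kij.1 kij.2.1 kij.2.2| <= C)).
  by move=> kij; exact: christoffel_bounded_near.
pose Cs := \sum_kij `|C kij|.
have C0 kij : `|C kij| <= Cs.
  by rewrite /Cs (bigD1 kij)//= lerDl sumr_ge0.
have Cs0 : 0 <= Cs by rewrite sumr_ge0.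
exists (Cs *+ m *+ m); first by rewrite !mulrn_wge0.
have near_C : \forall z \near y, forall kij : 'I_m * ('I_m * 'I_m),
    `|christoffel g c z kij.1 kij.2.1 kij.2.2| <= C kij.
  exact: (@filter_forall _ _ (fun (kij : 'I_m * ('I_m * 'I_m)) z =>
    `|christoffel g c z kij.1 kij.2.1 kij.2.2| <= C kij) (nbhs y) (nbhs_filter y) HC).
apply: filterS near_C => z zC w k.
apply: le_trans (ler_norm_sum _ _ _) _.
apply: (@le_trans _ _ (\sum_(i < m) (Cs *+ m * `|w| ^+ 2))); last first.
  by rewrite sumr_const card_ord -mulrnAl.
apply: ler_sum => i _; apply: le_trans (ler_norm_sum _ _ _) _.
apply: (@le_trans _ _ (\sum_(j < m) (Cs * `|w| ^+ 2))); last first.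
  by rewrite sumr_const card_ord -mulrnAl.
apply: ler_sum => j _; rewrite -mulrA normrM [`|w ord0 i * _|]normrM expr2.
apply: ler_pM; [exact: normr_ge0|exact: mulr_ge0| |].
  by apply: le_trans (C0 (k, (i, j))); apply: le_trans (zC (k, (i, j))) (ler_norm _).
by apply: ler_pM => //; exact: coord_le_mx_norm.
Qed.

End christoffel_bound.

Section geodesic_estimate.
Context (R : realType) (m : nat) (M : manifold R m) (g : riemannian_metric M).
Context (d : chart R m M) (a : 'rV[R]_m) (C delta : R).
Hypothesis ad : atlas d.
Hypothesis C0 : 0 <= C.
Hypothesis ball_image : forall y : 'rV[R]_m, `|y - a| < delta -> chart_image d y.
Hypothesis christoffel_le : forall y w : 'rV[R]_m, `|y - a| < delta -> forall k,
  `|\sum_i \sum_j christoffel g d y k i j * w ord0 i * w ord0 j| <= C * `|w| ^+ 2.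

Lemma closed_chart_cube (r : R) : r < delta ->
  closed [set p : M | dom d p /\ `|fwd d p - a| <= r].
Proof.
move=> rd; apply: (@closed_chart_preimage _ _ _ d [set y | `|y - a| <= r]) => //.
  have -> : [set y | `|y - a| <= r] = closed_ball_ Num.norm a r.
    by apply/funext => y; rewrite /closed_ball_ /= distrC.
  apply: bounded_closed_compact; last exact: closed_closed_ball_.
  exists (`|a| + r); split; first exact: num_real.
  move=> b rb y; rewrite /closed_ball_/= distrC => yr.
  rewrite -[y](subrK a); apply: le_trans (ler_normD _ _) _.
  by rewrite (le_trans _ (ltW rb))// addrC lerD2l.
by move=> y /= yr; apply: ball_image; exact: le_lt_trans rd.
Qed.

Variables (s : R -> M) (e rho : R).
Hypothesis e0 : 0 < e.
Hypothesis geo : geodesic g `](- e), (1 + e)[ s.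
Hypothesis s0 : dom d (s 0).
Let u : R -> 'rV[R]_m := fwd d \o s.
Hypothesis u0 : u 0 = a.
Hypothesis rho0 : 0 < rho.
Hypothesis du0 : `|'D_1 u 0| <= rho.
Hypothesis rho_small : 4 * C * rho < 1.
Hypothesis rho_delta : 2 * rho < delta.

Let inI (t : R) : 0 <= t <= 1 -> `](- e), (1 + e)[%classic t.
Proof. by move=> /andP[t0 t1]; rewrite /= in_itv/=; have := e0; lra. Qed.

Let cs (t : R) : 0 <= t <= 1 -> {for t, continuous s}.
Proof. by move=> /inI It; exact: (geo.1 0%N).1. Qed.

Let du t : 0 <= t <= 1 -> dom d (s t) ->
  [/\ derivable u t 1, {for t, continuous ('D_1 u)} & derivable ('D_1 u) t 1].
Proof.
move=> /inI It dt; have [_ /(_ 1)[du1 [cdu /(_ 1)[ddu _]]]] := (geo.1 2%N).2 d ad.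
by split; [exact: du1|exact: cdu|exact: ddu].
Qed.

Let stays (t : R) := [/\ dom d (s t), `|u t - a| <= 2 * rho & `|'D_1 u t| <= 2 * rho].

Let drift_ge0 : 0 <= 4 * C * rho ^+ 2.
Proof. exact: mulr_ge0 (mulr_ge0 (ler0n _ 4) C0) (sqr_ge0 rho). Qed.

(** The factor 4 is the square of the 2 that bounds the velocity in [stays]. *)
Let acceleration_le t : 0 <= t <= 1 -> stays t ->
  `|'D_1 ('D_1 u) t| <= 4 * C * rho ^+ 2.
Proof.
move=> t01 [dt ut dut].
apply: mx_norm_leP => // i k; rewrite (ord1 i).
have := geo.2 d t ad (inI t01) dt k; rewrite -/u.
have -> : derive1 u = 'D_1 u by apply/funext => r; rewrite derive1E.
rewrite derive1E => /eqP; rewrite addr_eq0 => /eqP ->; rewrite normrN.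
apply: le_trans (christoffel_le _ _ _) _; first exact: le_lt_trans rho_delta.
have : `|'D_1 u t| ^+ 2 <= (2 * rho) ^+ 2 by rewrite lerXn2r ?nnegrE//; have := rho0; lra.
rewrite exprMn => h; apply: le_trans (ler_wpM2l C0 h) _.
by rewrite le_eqVlt; apply/orP; left; apply/eqP; ring.
Qed.

Let drift_le t : 0 <= t <= 1 -> (forall r, 0 <= r <= t -> stays r) ->
  `|'D_1 u t - 'D_1 u 0| <= 4 * C * rho ^+ 2.
Proof.
move=> /andP[t0 t1] st.
have r01 r : 0 <= r <= t -> 0 <= r <= 1 by case/andP => -> /le_trans ->.
have := @mean_value_rV R m ('D_1 u) 0 (4 * C * rho ^+ 2) 0 t t0 _ _.
rewrite scaler0 !subr0 => h; apply: le_trans (h _ _) _.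
- by move=> r /[dup] rt /st[dr _ _]; have [] := du (r01 _ rt) dr.
- by move=> r /[dup] rt /st sr; rewrite subr0; apply: acceleration_le => //; exact: r01.
- by rewrite ler_piMr.
Qed.

Let displacement_le t : 0 <= t <= 1 -> (forall r, 0 <= r <= t -> stays r) ->
  `|u t - a - t *: 'D_1 u 0| <= 4 * C * rho ^+ 2.
Proof.
move=> /andP[t0 t1] st.
have r01 r : 0 <= r <= t -> 0 <= r <= 1 by case/andP => -> /le_trans ->.
have := @mean_value_rV R m u ('D_1 u 0) (4 * C * rho ^+ 2) 0 t t0 _ _.
rewrite u0 subr0 => h; apply: le_trans (h _ _) _.
- by move=> r /[dup] rt /st[dr _ _]; have [] := du (r01 _ rt) dr.
- move=> r /[dup] /andP[r0 rt] rt'; apply: drift_le; first exact: r01.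
  by move=> q /andP[q0 qr]; apply: st; rewrite q0 (le_trans qr).
- by rewrite ler_piMr.
Qed.

Let bound_lt : rho + 4 * C * rho ^+ 2 < 2 * rho.
Proof.
have : 4 * C * rho * rho < 1 * rho by rewrite ltr_pM2r.
lra.
Qed.

(** The bounds in [stays] pass to the limit, by [closed_chart_cube] as far as the
domain of the chart is concerned. When they hold up to time [t], the geodesic
equation improves the factor 2 to [1 + 4 C rho < 2], so they hold a little
longer. *)
Let geodesic_stays t : 0 <= t <= 1 -> stays t.
Proof.
move: t; apply: segment_induction.
- by split=> //; [rewrite u0 subrr normr0; have := rho0; lra|have := rho0; have := du0; lra].
- move=> t t01 st; have t01' : 0 <= t <= 1 by case/andP: t01 => t0 ->; rewrite ltW.
  have t_gt0 : 0 < t by case/andP: t01.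
  have [dt ut] : [set p : M | dom d p /\ `|fwd d p - a| <= 2 * rho] (s t).
    apply: contrapT => nK.
    have /closed_openC oK := closed_chart_cube rho_delta.
    have nbK : nbhs (s t) (~` [set p : M | dom d p /\ `|fwd d p - a| <= 2 * rho]).
      by apply: open_nbhs_nbhs; split.
    have near_K : \forall r \near t, ~ (dom d (s r) /\ `|u r - a| <= 2 * rho).
      exact: (cs t01' nbK).
    near (t^'-) => r.
    have : ~ (dom d (s r) /\ `|u r - a| <= 2 * rho) by near: r; exact: cvg_within near_K.
    have rt : r < t by near: r; exact: nbhs_left_lt.
    have r0 : 0 < r by near: r; exact: nbhs_left_gt.
    by apply; have [] : stays r by apply: st; rewrite ltW.
  split=> //; have [_ cdu _] := du t01' dt.
  apply/ler_addgt0Pr => b b0.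
  have near_u : \forall r \near t, `|'D_1 u t - 'D_1 u r| < b.
    by move/cvgrPdist_lt : cdu => /(_ _ b0).
  near (t^'-) => r.
  have ur : `|'D_1 u t - 'D_1 u r| < b by near: r; exact: cvg_within near_u.
  have rt : r < t by near: r; exact: nbhs_left_lt.
  have r0 : 0 < r by near: r; exact: nbhs_left_gt.
  have [_ _ dur] : stays r by apply: st; rewrite ltW.
  rewrite -['D_1 u t](subrK ('D_1 u r)); apply: le_trans (ler_normD _ _) _.
  by rewrite addrC; apply: lerD => //; exact: ltW.
- move=> t t01 st; have t01' : 0 <= t <= 1 by case/andP: t01 => -> t1; rewrite ltW.
  have [dt _ _] : stays t by apply: st; rewrite lexx andbT; case/andP: t01.
  have [dut cdu _] := du t01' dt.
  have ut : `|u t - a| < 2 * rho.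
    have h := displacement_le t01' st.
    have h2 : `|t *: 'D_1 u 0| <= rho.
      rewrite normrZ ger0_norm; last by case/andP: t01'.
      by apply: le_trans du0; rewrite ler_piMl//; case/andP: t01'.
    rewrite -[u t - a](subrK (t *: 'D_1 u 0)); apply: le_lt_trans (ler_normD _ _) _.
    have := bound_lt; have := du0; lra.
  have vt : `|'D_1 u t| < 2 * rho.
    have h := drift_le t01' st.
    rewrite -['D_1 u t](subrK ('D_1 u 0)); apply: le_lt_trans (ler_normD _ _) _.
    have := bound_lt; have := du0; lra.
  have near_d : \forall r \near t, dom d (s r) := cs t01' (chart_near_dom ad dt).
  have cu := derivable_continuous dut.
  have b0 : 0 < 2 * rho - `|u t - a| by lra.
  have b0' : 0 < 2 * rho - `|'D_1 u t| by lra.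
  have near_u : \forall r \near t, `|u t - u r| < 2 * rho - `|u t - a|.
    by move/cvgrPdist_lt : cu => /(_ _ b0).
  have near_v : \forall r \near t, `|'D_1 u t - 'D_1 u r| < 2 * rho - `|'D_1 u t|.
    by move/cvgrPdist_lt : cdu => /(_ _ b0').
  suff near_s : \forall r \near t, stays r by exact: cvg_within near_s.
  apply: filterS3 near_d near_u near_v => r dr ur vr; split; first exact: dr.
    rewrite -(subrK (u t) (u r)) -addrA; apply: le_trans (ler_normD _ _) _.
    by rewrite distrC; lra.
  rewrite -(subrK ('D_1 u t) ('D_1 u r)); apply: le_trans (ler_normD _ _) _.
  by rewrite distrC; lra.
Unshelve. all: by end_near. Qed.

Lemma geodesic_endpoint_estimate :
  `|fwd d (s 1) - a - 'D_1 u 0| <= 4 * C * rho ^+ 2.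
Proof.
have := @displacement_le 1; rewrite scale1r; apply; first by rewrite ler01 lexx.
exact: geodesic_stays.
Qed.

End geodesic_estimate.

(** * The metric at the center of a normal chart *)

Section normal_chart_metric.
Context (R : realType) (m : nat) (M : manifold R m) (g : riemannian_metric M).
Context (x : M) (phi : chart R m M).

(** In the coordinates that define the tangent space at [x], the exponential map
is [w |-> fwd x + w + O(|w|^2)]. The bound [rho] of [|w|] is kept separate and
positive so that [w = 0] does not have to be treated apart. *)
Lemma exp_map_second_order : exists rho0 L : R, [/\ 0 < rho0, 0 <= L &
  forall (w : 'rV[R]_m) (rho : R) p, 0 < rho < rho0 -> `|w| <= rho ->
    exp_map g x w p ->
    `|fwd (chart_at x) p - fwd (chart_at x) x - w| <= L * rho ^+ 2].
Proof.
have [ad dx] := chart_atP x; set d := chart_at x in ad dx *; set a := fwd d x.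
have cy : chart_image d a by exists x.
have [C C0 near_C] := christoffel_quadratic_bound g ad cy.
have near_c : \forall z \near a, chart_image d z.
  by apply: open_nbhs_nbhs; split => //; exact: chart_image_open.
have : nbhs a [set z | chart_image d z /\ forall (w : 'rV[R]_m) k,
    `|\sum_i \sum_j christoffel g d z k i j * w ord0 i * w ord0 j| <= C * `|w| ^+ 2].
  by apply: filterS2 near_c near_C.
move=> /nbhs_ballP[delta /= delta0 near_a].
have in_ball (y : 'rV[R]_m) : `|y - a| < delta -> ball a delta y.
  by rewrite -ball_normE/= distrC.
(* [r1] keeps the geodesic in the ball, [r2] gives [4 * C * rho < 1]. *)
pose r1 := delta / 2; pose r2 := (4 * C + 1)^-1.
have r10 : 0 < r1 by rewrite divr_gt0.
have r20 : 0 < r2 by rewrite invr_gt0; lra.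
exists (Num.min r1 r2), (4 * C); split; [by rewrite lt_min r10|by rewrite mulr_ge0|].
move=> w rho p /andP[rho0]; rewrite lt_min => /andP[rr1 rr2] wr.
move=> [s [e [e0 geo s0 vs <-]]].
have s0E : fwd d \o s = fwd (chart_at (s 0)) \o s by rewrite s0.
have v0 : 'D_1 (fwd d \o s : R -> 'rV[R]_m) 0 = w.
  by rewrite -vs /velocity derive1E s0E.
rewrite -v0; apply: (geodesic_endpoint_estimate (delta := delta) ad C0 _ _ e0 geo _ _ rho0).
- by move=> y /in_ball/near_a[].
- by move=> y v /in_ball/near_a[_]; apply.
- by rewrite s0.
- by rewrite /= s0.
- by rewrite v0.
- have : 4 * C * rho <= (4 * C + 1) * rho by rewrite ler_pM2r//; lra.
  move/le_lt_trans; apply.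
  by rewrite -ltr_pdivlMl ?mulr1//; lra.
- by rewrite mulrC -ltr_pdivlMr.
Qed.

(** By [exp_map_second_order] the change of coordinates from [phi] to [chart_at x] has
at the origin the derivative [v |-> v *m B], and the rows of [B] are orthonormal at [x]. *)
Lemma normal_chart_gram : normal_chart g x phi -> g phi 0 = 1%:M.
Proof.
move=> [aphi phix phi0 [B [B1 Bexp]]].
have [ad dx] := chart_atP x; set d := chart_at x in ad dx.
pose T := transition phi d.
have T0 : T 0 = fwd d x by rewrite /T /transition/= -phi0 chart_fwdK.
have dT : differentiable T 0.
  by rewrite -phi0; exact: transition_differentiable.
have [rho0 [L [rho00 L0 expL]]] := exp_map_second_order.
have img0 : chart_image phi 0 by exists x.
have near_img : \forall y \near (0 : 'rV[R]_m), chart_image phi y.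
  by apply: open_nbhs_nbhs; split => //; exact: chart_image_open.
have DT (v : 'rV[R]_m) : 'D_v T 0 = v *m B.
  pose K := `|v *m B| + 1.
  have K0 : 0 < K by rewrite /K ltr_wpDl.
  apply/cvg_lim => //; apply/cvgrPdist_le => /= e e0.
  have near_v : \forall h \near (0 : R)^', chart_image phi (h *: v).
    suff : \forall h \near (0 : R), chart_image phi (h *: v) by exact: cvg_within.
    have line0 : 0 + h *: v @[h --> (0 : R)] --> (0 : 'rV[R]_m).
      by have := @line_continuous R m 0 v 0; rewrite scale0r addr0.
    have near_h : \forall h \near (0 : R), chart_image phi (0 + h *: v) := line0 _ near_img.
    by near=> h; rewrite -[h *: v]add0r; near: h.
  near=> h.
  have h0 : h != 0 by near: h; exact: nbhs_dnbhs_neq.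
  have h_gt0 : 0 < `|h| by rewrite normr_gt0.
  have hv : chart_image phi (h *: v) by near: h.
  have hr : `|h| < rho0 / K by near: h; apply: dnbhs0_lt; exact: divr_gt0.
  have he : `|h| < e / (L * K ^+ 2 + 1).
    near: h; apply: dnbhs0_lt; apply: divr_gt0 => //.
    by rewrite ltr_wpDl// mulr_ge0// sqr_ge0.
  have := expL (h *: v *m B) (`|h| * K) (bwd phi (h *: v)) _ _ _.
  rewrite -/d -T0 addr0.
  have -> : (h^-1 *: (T (h *: v) - T 0)) = h^-1 *: (T (h *: v) - T 0 - h *: v *m B) + v *m B.
    by rewrite [in RHS]scalerBr -scalemxAl scalerA mulVf// scale1r subrK.
  move=> est; rewrite opprD addrCA subrr addr0 normrN normrZ normfV ler_pdivrMl//.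
  apply: le_trans (est _ _ _) _.
  - by rewrite mulr_gt0//= -ltr_pdivlMr.
  - by rewrite -scalemxAl normrZ ler_pM2l// lerDl.
  - by have := Bexp _ (chart_dom_bwd aphi hv); rewrite chart_bwdK.
  rewrite exprMn mulrCA expr2 -mulrA ler_pM2l//.
  have L1 : 0 < L * K ^+ 2 + 1 by rewrite ltr_wpDl// mulr_ge0// sqr_ge0.
  move: he; rewrite ltr_pdivlMr// => /ltW; apply: le_trans.
  by rewrite ler_pM2l// lerDl.
have J : jacobian T 0 = B.
  by apply/row_matrixP => i; rewrite !rowE -DT deriveEjacobian.
rewrite -phi0 (gram_transition g aphi ad phix dx) -/T.
have -> : fwd phi x = 0 by [].
by rewrite J.
Unshelve. all: by end_near. Qed.

End normal_chart_metric.

(** * Lebesgue measure in Euclidean balls *)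

Section euclidean_ball_measure.
Context (R : realType) (m : nat).
Local Notation L := (@lebesgue_rV R m).
Local Notation B := (euclidean_ball (0 : 'rV[R]_m)).

Lemma euclidean_ball0E (r : R) : B r = [set y | enorm y < r].
Proof. by rewrite euclidean_ballE; apply/funext => y /=; rewrite subr0. Qed.

Lemma euclidean_ball_dilate (r : R) : 0 < r -> B r = dilate r (B 1).
Proof.
move=> r0; rewrite !euclidean_ball0E; apply/seteqP; split => [y /= yr|_ [y /= y1 <-]].
  exists (r^-1 *: y); last by rewrite scalerA mulfV ?gt_eqF// scale1r.
  by rewrite /= enormZ gtr0_norm ?invr_gt0// mulrC ltr_pdivrMr// mul1r.
by rewrite enormZ gtr0_norm// gtr_pMr.
Qed.

Lemma measurable_euclidean_ball (r : R) : L.-cara.-measurable (B r).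
Proof. exact/open_measurable_rV/open_euclidean_ball. Qed.

Lemma lebesgue_unit_ball_fin : L (B 1) \is a fin_num.
Proof.
rewrite ge0_fin_numE ?lebesgue_rV_ge0//.
apply: (@lebesgue_rV_bounded_lt_pinfty _ _ 1) => // y.
by rewrite euclidean_ball0E /= => y1 i; exact: le_lt_trans (coord_le_enorm y i) y1.
Qed.

Definition unit_ball_volume : R := fine (L (B 1)).

Lemma unit_ball_volume_ge0 : 0 <= unit_ball_volume.
Proof. by rewrite fine_ge0// lebesgue_rV_ge0. Qed.

Lemma lebesgue_euclidean_ball (r : R) : 0 < r -> L (B r) = (unit_ball_volume * r ^+ m)%:E.
Proof.
move=> r0; rewrite euclidean_ball_dilate// lebesgue_rV_dilate//.
by rewrite mulrC EFinM fineK// lebesgue_unit_ball_fin.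
Qed.

(** Passing from [B1] to [B2] increases the part in [A] by at most the measure of
the difference of [B2] and [B1]; stated with sums, this makes sense for
infinite measures too. *)
Lemma lebesgue_rV_increment (A B1 B2 : set 'rV[R]_m) : B1 `<=` B2 ->
  L.-cara.-measurable B1 ->
  (L (A `&` B2) + L B1 <= L (A `&` B1) + L B2)%E.
Proof.
move=> B12 mB1; rewrite (mB1 (A `&` B2)) [X in (_ <= _ + X)%E](mB1 B2).
rewrite -setIA (setIidr B12) [X in (_ <= X)%E]addeCA addeC.
apply: leeD => //; apply: leeD => //.
by apply: le_lebesgue_rV => y [[_ ? ?]].
Qed.

Definition ball_mass (A : set 'rV[R]_m) (r : R) := fine (L (A `&` B r)).

Lemma ball_massK A (r : R) : 0 < r -> L (A `&` B r) = (ball_mass A r)%:E.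
Proof.
move=> r0; rewrite fineK// ge0_fin_numE ?lebesgue_rV_ge0//.
apply: (@le_lt_trans _ _ (L (B r))); first by apply: le_lebesgue_rV => y [].
by rewrite lebesgue_euclidean_ball// ltry.
Qed.

Lemma ball_mass_ge0 A r : 0 <= ball_mass A r.
Proof. by rewrite fine_ge0// lebesgue_rV_ge0. Qed.

Lemma ball_mass_le A (r : R) : 0 < r -> ball_mass A r <= unit_ball_volume * r ^+ m.
Proof.
move=> r0; rewrite -lee_fin -ball_massK// -lebesgue_euclidean_ball//.
by apply: le_lebesgue_rV => y [].
Qed.

Lemma ball_mass_increment A (r s : R) : 0 < r -> r <= s ->
  ball_mass A s + unit_ball_volume * r ^+ m <=
  ball_mass A r + unit_ball_volume * s ^+ m.
Proof.
move=> r0 rs; have s0 := lt_le_trans r0 rs.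
rewrite -lee_fin !EFinD -!ball_massK// -!lebesgue_euclidean_ball//.
apply: lebesgue_rV_increment; last exact: measurable_euclidean_ball.
by rewrite !euclidean_ball0E => y /= yr; exact: lt_le_trans rs.
Qed.

End euclidean_ball_measure.

(** * Small distortion near the center *)

Section small_distortion.
Context (R : realType) (m : nat) (M : manifold R m) (g : riemannian_metric M).
Context (c : chart R m M).
Hypothesis ac : atlas c.
Hypothesis image0 : chart_image c 0.
Hypothesis gram0 : g c 0 = 1%:M.

Definition small_distortion (eps delta : R) := forall y : 'rV[R]_m,
  enorm y < delta ->
  [/\ chart_image c y, 1 - eps <= Num.sqrt (\det (g c y)) <= 1 + eps &
    forall v, (1 - eps) * enorm v <= gnorm g c y v <= (1 + eps) * enorm v].

Lemma enorm_sqr_mx (v : 'rV[R]_m) : enorm v ^+ 2 = (v *m v^T) ord0 ord0.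
Proof. by rewrite enorm_sqr mxE; apply: eq_bigr => i _; rewrite mxE. Qed.

Lemma quadratic_form_le (A : 'M[R]_m) (v : 'rV[R]_m) (eta : R) :
  (forall i j, `|A i j| <= eta) ->
  `|(v *m A *m v^T) ord0 ord0| <= (eta *+ m *+ m) * enorm v ^+ 2.
Proof.
move=> Aeta; rewrite mxE; apply: le_trans (ler_norm_sum _ _ _) _.
apply: (@le_trans _ _ (\sum_(i < m) (eta *+ m * enorm v ^+ 2))); last first.
  by rewrite sumr_const card_ord -mulrnAl.
apply: ler_sum => j _; rewrite !mxE normrM expr2 mulrA.
apply: ler_pM => //; last exact: coord_le_enorm.
apply: le_trans (ler_norm_sum _ _ _) _.
apply: (@le_trans _ _ (\sum_(i < m) (eta * enorm v))); last first.
  by rewrite sumr_const card_ord -mulrnAl.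
apply: ler_sum => i _; rewrite normrM mulrC; apply: ler_pM => //.
exact: coord_le_enorm.
Qed.

(** Both the quadratic form and the determinant depend continuously on the Gram
matrix. For the norms it is convenient that
[(1 - eps)^2 <= 1 - eps] and [1 + eps <= (1 + eps)^2]. *)
Lemma small_distortion_exists (eps : R) : 0 < eps < 1 ->
  exists2 delta, 0 < delta & small_distortion eps delta.
Proof.
move=> /andP[eps0 eps1].
have near_c : \forall y \near (0 : 'rV[R]_m), chart_image c y.
  by apply: open_nbhs_nbhs; split => //; exact: chart_image_open.
have cg : g c y @[y --> (0 : 'rV[R]_m)] --> g c 0.
  by have [+ _] := gram_smooth g ac 0; apply.
have FF : Filter (nbhs (0 : 'rV[R]_m)) := nbhs_filter _.
have cdet : Num.sqrt (\det (g c y)) @[y --> (0 : 'rV[R]_m)] --> (1 : R).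
  have -> : 1 = Num.sqrt (\det (g c 0)) by rewrite gram0 det1 sqrtr1.
  apply: (@cvg_comp _ _ _ (fun y => \det (g c y)) Num.sqrt _ (nbhs (\det (g c 0)))).
    exact: cvg_det.
  exact: sqrt_continuous.
have near_det : \forall y \near (0 : 'rV[R]_m), `|1 - Num.sqrt (\det (g c y))| < eps.
  by move/cvgrPdist_lt : cdet => /(_ _ eps0).
pose eta := eps / (m * m).+1%:R.
have eta0 : 0 < eta by rewrite divr_gt0.
have eta_eps : eta *+ m *+ m <= eps.
  have -> : eps = eta *+ (m * m).+1 by rewrite -mulr_natr divfK// pnatr_eq0.
  by rewrite -mulrnA mulrS lerDr ltW.
have near_g : \forall y \near (0 : 'rV[R]_m), `|g c 0 - g c y| < eta.
  by move/cvgrPdist_lt : cg => /(_ _ eta0).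
have : nbhs (0 : 'rV[R]_m) [set y | [/\ chart_image c y,
    `|1 - Num.sqrt (\det (g c y))| < eps & `|g c 0 - g c y| < eta]].
  by apply: filterS3 near_c near_det near_g.
move=> /nbhs_ballP[delta /= delta0 near0]; exists delta => // y yd.
have [|cy dety gy] := near0 y.
  by rewrite -ball_normE/= sub0r normrN; exact: le_lt_trans (mx_norm_le_enorm y) yd.
split=> //; first by move: dety; rewrite ltr_norml; lra.
move=> v; have v0 := enorm_ge0 v; pose q := (v *m g c y *m v^T) ord0 ord0.
have q_le : `|enorm v ^+ 2 - q| <= eps * enorm v ^+ 2.
  have -> : enorm v ^+ 2 - q = (v *m (g c 0 - g c y) *m v^T) ord0 ord0.
    have mxB (A B : 'M[R]_1) : (A - B) ord0 ord0 = A ord0 ord0 - B ord0 ord0 by rewrite !mxE.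
    by rewrite mulmxBr mulmxBl gram0 mulmx1 mxB -enorm_sqr_mx.
  apply: le_trans (quadratic_form_le _ _) _.
    by move=> i j; apply: le_trans (coord_le_mx_norm _ i j) (ltW gy).
  by rewrite ler_wpM2r// sqr_ge0.
move: q_le; rewrite ler_norml => /andP[q1 q2].
have n0 := sqr_ge0 (enorm v).
rewrite /gnorm -/q; apply/andP; split.
  rewrite -[leLHS]ger0_norm; last by rewrite mulr_ge0// subr_ge0 ltW.
  rewrite -sqrtr_sqr ler_wsqrtr// exprMn.
  have : eps * eps * enorm v ^+ 2 <= eps * enorm v ^+ 2 by rewrite ler_wpM2r// ler_piMr// ltW.
  rewrite [(1 - eps) ^+ 2]expr2; lra.
rewrite -[leRHS]ger0_norm; last by rewrite mulr_ge0// addr_ge0// ltW.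
rewrite -sqrtr_sqr ler_wsqrtr// exprMn.
have : 0 <= eps * eps * enorm v ^+ 2 by rewrite !mulr_ge0// ltW.
have : 0 <= eps * enorm v ^+ 2 by rewrite !mulr_ge0// ltW.
rewrite [(1 + eps) ^+ 2]expr2; lra.
Qed.

End small_distortion.

(** * Comparison of the masses of balls *)

Section real_estimates.
Context (R : realType).

(** The two products are the total distortions of the measure of a ball: one factor for the
volume density, and [m] factors for the change of the radius. *)
Lemma distortion_constants (m : nat) (eta : R) : 0 < eta ->
  exists2 eps : R, 0 < eps < 1 &
    (1 + eps) * ((1 - eps)^-1) ^+ m <= 1 + eta /\
    1 - eta <= (1 - eps) * ((1 + eps)^-1) ^+ m.
Proof.
move=> eta0.
have cadd : (1 + e) @[e --> (0 : R)] --> (1 : R).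
  by rewrite -[X in _ --> X]addr0; apply: cvgD; [exact: cvg_cst|exact: cvg_id].
have csub : (1 - e) @[e --> (0 : R)] --> (1 : R).
  by rewrite -[X in _ --> X]subr0; apply: cvgB; [exact: cvg_cst|exact: cvg_id].
have cpow (f : R -> R) : f e @[e --> (0 : R)] --> (1 : R) ->
    (f e)^-1 ^+ m @[e --> (0 : R)] --> (1 : R).
  move=> cf; have cV : (f e)^-1 @[e --> (0 : R)] --> (1 : R).
    by rewrite -[X in _ --> X]invr1; apply: cvgV => //; exact: oner_neq0.
  rewrite -[X in _ --> X](expr1n _ m).
  apply: (@cvg_comp _ _ _ (fun e => (f e)^-1) (fun y => y ^+ m) _ (nbhs (1 : R))) => //.
  exact: exprn_continuous.
have cp : (1 + e) * (1 - e)^-1 ^+ m @[e --> (0 : R)] --> (1 : R).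
  by rewrite -[X in _ --> X]mulr1; apply: cvgM => //; exact: cpow.
have cq : (1 - e) * (1 + e)^-1 ^+ m @[e --> (0 : R)] --> (1 : R).
  by rewrite -[X in _ --> X]mulr1; apply: cvgM => //; exact: cpow.
have near_p : \forall e \near (0 : R), `|1 - (1 + e) * (1 - e)^-1 ^+ m| < eta.
  by move/cvgrPdist_lt : cp => /(_ _ eta0).
have near_q : \forall e \near (0 : R), `|1 - (1 - e) * (1 + e)^-1 ^+ m| < eta.
  by move/cvgrPdist_lt : cq => /(_ _ eta0).
near ((0 : R)^'+) => e; exists e.
  by apply/andP; split; near: e; [exact: nbhs_right_gt|exact: nbhs_right_lt].
have : `|1 - (1 + e) * (1 - e)^-1 ^+ m| < eta by near: e; exact: cvg_within near_p.
have : `|1 - (1 - e) * (1 + e)^-1 ^+ m| < eta by near: e; exact: cvg_within near_q.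
by rewrite !ltr_norml; lra.
Unshelve. all: by end_near. Qed.

(** When [w > 0], the denominator [u] is at least [w / 2]; when [w = 0], all the
numerators vanish and so do the quotients. *)
Lemma ratio_perturbation (alpha w u v eta : R) :
  0 <= alpha <= w -> 0 <= eta <= 2^-1 ->
  `|v - alpha| <= eta * w -> `|u - w| <= eta * w ->
  `|v / u - alpha / w| <= 4 * eta.
Proof.
move=> /andP[a0 aw] /andP[eta0 eta2] va uw; have w0 := le_trans a0 aw.
move: w0; rewrite le_eqVlt => /predU1P[w0|w_gt0].
  have a_eq0 : alpha = 0 by apply/eqP; rewrite eq_le a0 w0 aw.
  move: va; rewrite -w0 mulr0 a_eq0 subr0 normr_le0 => /eqP ->.
  by rewrite !mul0r subr0 normr0 mulr_ge0.
have wu : w <= 2 * u.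
  have : eta * w <= 2^-1 * w by rewrite ler_pM2r.
  move: uw; rewrite ler_norml; lra.
have u0 : 0 < u by lra.
have -> : v / u - alpha / w = ((v - alpha) + alpha / w * (w - u)) / u.
  by field; rewrite !gt_eqF.
rewrite normrM normfV (gtr0_norm u0) ler_pdivrMr//.
apply: le_trans (ler_normD _ _) _; rewrite normrM distrC.
have aw1 : `|alpha / w| <= 1.
  by rewrite ger0_norm ?divr_ge0 ?(ltW w_gt0)// ler_pdivrMr// mul1r.
have h : `|alpha / w| * `|w - u| <= 1 * (eta * w).
  by apply: ler_pM => //; rewrite distrC.
have : 2 * eta * w <= 2 * eta * (2 * u) by rewrite ler_wpM2l// mulr_ge0.
by rewrite distrC in va; lra.
Qed.

End real_estimates.

Section mass_comparison.
Context (R : realType) (m : nat) (M : manifold R m) (g : riemannian_metric M).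
Context (vol : {measure set (measurable_manifold M) -> \bar R}).
Hypothesis hvol : is_volume g vol.
Context (x : M) (phi : chart R m M).
Hypothesis aphi : atlas phi.
Hypothesis phix : dom phi x.
Hypothesis phi0 : fwd phi x = 0.
Local Notation L := (@lebesgue_rV R m).
Local Notation B := (euclidean_ball (0 : 'rV[R]_m)).
Local Notation omega := (unit_ball_volume R m).

(** The bound on [r] makes the radius obtained from
[riemannian_dist_ge_chart_radius] smaller than [delta], which is what places
the point inside the chart. *)
Lemma riemannian_ball_in_chart (eps delta r : R) p : 0 < eps < 1 -> 0 < delta ->
  small_distortion g phi eps delta -> 0 < r < (1 - eps) * delta ->
  riemannian_ball g x r p -> dom phi p /\ enorm (fwd phi p) < r / (1 - eps).
Proof.
move=> /andP[eps0 eps1] delta0 sd /andP[r0 rd] pr.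
have k0 : 0 < 1 - eps by rewrite subr_gt0.
have ball_image y : enorm y < delta -> chart_image phi y by move=> /sd[].
have gnorm_ge y v : enorm y < delta -> (1 - eps) * enorm v <= gnorm g phi y v.
  by move=> /sd[_ _ /(_ v)/andP[]].
have cx : near_center phi delta x by split=> //; rewrite phi0 enorm0.
have := riemannian_dist_ge_chart_radius aphi k0 ball_image gnorm_ge x p.
move=> /le_lt_trans/(_ pr); rewrite lte_fin (chart_radius_in cx) phi0 enorm0 subr0 => h.
have hp : chart_radius phi delta p < r / (1 - eps) by rewrite ltr_pdivlMr// mulrC.
have pc : near_center phi delta p.
  apply: near_centerP; apply: lt_trans hp _; by rewrite ltr_pdivrMr// mulrC.
by rewrite -(chart_radius_in pc); split => //; exact: pc.1.
Qed.

Lemma euclidean_ball_in_riemannian_ball (eps delta r : R) y : 0 < eps < 1 ->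
  small_distortion g phi eps delta -> 0 < r < delta ->
  enorm y < r / (1 + eps) ->
  chart_image phi y /\ riemannian_ball g x r (bwd phi y).
Proof.
move=> /andP[eps0 eps1] sd /andP[r0 rd] yr.
have K0 : 0 < 1 + eps by rewrite addr_gt0.
have yd : enorm y < delta.
  apply: lt_trans yr _; apply: le_lt_trans rd.
  by rewrite ler_pdivrMr// mulrDr mulr1 lerDl mulr_ge0// ltW.
split; first by have [] := sd _ yd.
have ball_image z : enorm z < delta -> chart_image phi z by move=> /sd[].
have gnorm_le z v : enorm z < delta -> gnorm g phi z v <= (1 + eps) * enorm v.
  by move=> /sd[_ _ /(_ v)/andP[]].
have := riemannian_dist_center_le aphi phix phi0 (ltW K0) ball_image gnorm_le yd.
by move=> /le_lt_trans; apply; rewrite lte_fin mulrC -ltr_pdivlMr.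
Qed.

Variables (E : set M).
Hypothesis mE : manifold_measurable E.
Let A := fwd phi @` (E `&` dom phi).

Lemma volume_between (eps delta r : R) : 0 < eps < 1 -> 0 < delta ->
  small_distortion g phi eps delta -> 0 < r < (1 - eps) * delta ->
  ((1 - eps)%:E * L (A `&` B (r / (1 + eps))) <= vol (E `&` riemannian_ball g x r)
   <= (1 + eps)%:E * L (A `&` B (r / (1 - eps))))%E.
Proof.
move=> eps01 delta0 sd rd; have /andP[eps0 eps1] := eps01; have /andP[r0 rdelta] := rd.
have k0 : 0 < 1 - eps by rewrite subr_gt0.
have rd' : 0 < r < delta.
  by rewrite r0 (lt_trans rdelta)// gtr_pMl// ltrBlDr ltrDl.
pose S := E `&` riemannian_ball g x r.
have Sdom : S `<=` dom phi.
  by move=> p [_ pr]; have [] := riemannian_ball_in_chart eps01 delta0 sd rd pr.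
have mS : manifold_measurable S.
  apply: manifold_measurableI => //.
  exact/open_manifold_measurable/riemannian_ball_open.
have SE : S `&` dom phi = S by exact/setIidl.
have mfS : L.-cara.-measurable (fwd phi @` S) by rewrite -SE; exact: mS.
rewrite (hvol aphi mS Sdom).
have dens y : (fwd phi @` S) y -> 1 - eps <= Num.sqrt (\det (g phi y)) <= 1 + eps.
  move=> [p Sp <-]; have [_ pr] := riemannian_ball_in_chart eps01 delta0 sd rd Sp.2.
  have [] := sd (fwd phi p) => //.
  by apply: lt_trans pr _; rewrite ltr_pdivrMr// mulrC.
have /andP[h1 h2] := integral_between mfS (ltW k0) dens.
apply/andP; split.
  apply: le_trans h1; apply: lee_wpmul2l; first by rewrite lee_fin ltW.
  apply: le_lebesgue_rV => _ [[p [Ep cp] <-]]; rewrite euclidean_ball0E/= => pr.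
  have [_] := euclidean_ball_in_riemannian_ball eps01 sd rd' pr.
  by rewrite chart_fwdK// => ballp; exists p.
apply: le_trans h2 _; apply: lee_wpmul2l; first by rewrite lee_fin addr_ge0 ?ltW.
apply: le_lebesgue_rV => _ [p Sp <-]; split.
  by exists p => //; split; [exact: Sp.1|exact: Sdom].
rewrite euclidean_ball0E/=.
by have [] := riemannian_ball_in_chart eps01 delta0 sd rd Sp.2.
Qed.

(** By [ball_mass_increment] the Euclidean balls of radii [r / (1 + eps)] and
[r / (1 - eps)] may be replaced by that of radius [r]; the resulting error is
at most a small multiple of the measure of the full ball. *)
Lemma riemannian_ball_mass_approx (eta : R) : 0 < eta -> (forall eps : R, 0 < eps < 1 ->
    exists2 delta, 0 < delta & small_distortion g phi eps delta) ->
  \forall r \near (0 : R)^'+,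
    `|fine (vol (E `&` riemannian_ball g x r)) - ball_mass A r| <=
    eta * (omega * r ^+ m).
Proof.
move=> eta0 sdn; have [eps eps01 [epsP epsQ]] := distortion_constants m eta0.
have [delta delta0 sd] := sdn _ eps01; have /andP[eps0 eps1] := eps01.
have k0 : 0 < 1 - eps by rewrite subr_gt0.
have K0 : 0 < 1 + eps by rewrite addr_gt0.
near=> r.
have r0 : 0 < r by near: r; exact: nbhs_right_gt.
have rd : 0 < r < (1 - eps) * delta.
  by rewrite r0; near: r; apply: nbhs_right_lt; rewrite mulr_gt0.
have u0 : 0 < r / (1 - eps) by rewrite divr_gt0.
have l0 : 0 < r / (1 + eps) by rewrite divr_gt0.
have /andP[] := volume_between eps01 delta0 sd rd.
rewrite !ball_massK// -!EFinM => V1 V2.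
have finV : vol (E `&` riemannian_ball g x r) \is a fin_num.
  by apply/fin_numPlt; rewrite (lt_le_trans (ltNyr _) V1) (le_lt_trans V2)// ltry.
rewrite -(fineK finV) !lee_fin in V1 V2.
set V := fine _ in V1 V2 *; clearbody V.
have ru : r <= r / (1 - eps).
  by rewrite ler_pdivlMr// ler_piMr ?(ltW r0)// lerBlDr lerDl ltW.
have lr : r / (1 + eps) <= r.
  by rewrite ler_pdivrMr// mulrDr mulr1 lerDl mulr_ge0// ltW.
have := ball_mass_increment A r0 ru; have := ball_mass_increment A l0 lr.
have := ball_mass_le A r0; have := ball_mass_ge0 A r.
move: V1 V2; rewrite !exprMn !mulrA; set w := omega * r ^+ m.
have w0 : 0 <= w by rewrite mulr_ge0 ?unit_ball_volume_ge0 ?exprn_ge0// ltW.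
move: epsP epsQ; set p := (1 - eps)^-1 ^+ m; set q := (1 + eps)^-1 ^+ m.
set al := ball_mass A r; set alow := ball_mass A (r / (1 + eps)).
set au := ball_mass A (r / (1 - eps)).
move=> epsP epsQ V1 V2 al0 alw incl incu.
have hw1 : (1 + eps) * p * w <= (1 + eta) * w by rewrite ler_wpM2r.
have hw2 : (1 - eta) * w <= (1 - eps) * q * w by rewrite ler_wpM2r.
have h1 : (1 + eps) * au <= (1 + eps) * (al + w * p - w) by rewrite ler_pM2l//; lra.
have h2 : (1 - eps) * (al + w * q - w) <= (1 - eps) * alow by rewrite ler_pM2l//; lra.
have h3 : eps * al <= eps * w by rewrite ler_pM2l.
rewrite -(mulrA eta) -/w ler_norml; apply/andP; split; lra.
Unshelve. all: by end_near. Qed.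

End mass_comparison.

(** * Conclusion *)

Section same_limits.
Context (R : realType) (F : set_system R) (FF : ProperFilter F).

(** The difference tends to 0, so [f] and [h] have the same limits; when there are
none, both values of [lim] are the same default point. *)
Lemma same_limit (f h : R -> R) : f r - h r @[r --> F] --> (0 : R) ->
  (cvg (f r @[r --> F]) <-> cvg (h r @[r --> F])) /\
  lim (f r @[r --> F]) = lim (h r @[r --> F]).
Proof.
move=> fh0.
have fhl (l : R) : (f r @[r --> F] --> l) <-> (h r @[r --> F] --> l).
  have fE : f = (fun r => h r + (f r - h r)).
    by apply/funext => r; rewrite addrC subrK.
  have hE : h = (fun r => f r - (f r - h r)).
    by apply/funext => r; rewrite opprB addrC subrK.
  split=> cl; first by rewrite hE -[l]subr0; exact: cvgB.
  by rewrite fE -[l]addr0; exact: cvgD.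
split; first by split=> /cvg_ex[l cl]; apply/cvg_ex; exists l; exact/fhl.
by rewrite /lim /lim_in; congr (get _); apply/funext => l; apply/propext; exact: fhl.
Qed.

End same_limits.

Theorem corollary5p18 (R : realType) (m : nat) (M : manifold R m)
    (g : riemannian_metric M)
    (vol : {measure set (measurable_manifold M) -> \bar R})
    (hvol : is_volume g vol)
    (E : set M) (hE : manifold_measurable E)
    (x : M) (phi : chart R m M) (hphi : normal_chart g x phi) :
  (cvg (density_ratio g vol E x r @[r --> 0^'+]) <->
   cvg (euclidean_density_ratio (fwd phi @` (E `&` dom phi)) (fwd phi x) r
          @[r --> 0^'+])) /\
  density g vol E x =
    euclidean_density (fwd phi @` (E `&` dom phi)) (fwd phi x).
Proof.
have gram1 := normal_chart_gram hphi.
have [aphi phix phi0 _] := hphi.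
have img0 : chart_image phi 0 by exists x.
have sd := small_distortion_exists aphi img0 gram1.
apply: same_limit; rewrite phi0.
pose omega := unit_ball_volume R m.
have mT : manifold_measurable [set: M] by exact: open_manifold_measurable openT.
have [delta delta0 ball_image] : exists2 delta : R, 0 < delta &
    forall y, enorm y < delta -> chart_image phi y.
  have [|delta delta0 sdd] := sd 2^-1; first lra.
  by exists delta => // y /sdd[].
apply/cvgr0Pnorm_le => eps eps0; pose eta := Num.min 2^-1 (eps / 4).
have eta0 : 0 < eta by rewrite lt_min invr_gt0 divr_gt0 ?ltr0n.
near=> r.
have r0 : 0 < r by near: r; exact: nbhs_right_gt.
have rd : r < delta by near: r; exact: nbhs_right_lt.
have approxE : `|fine (vol (E `&` riemannian_ball g x r)) -
    ball_mass (fwd phi @` (E `&` dom phi)) r| <= eta * (omega * r ^+ m).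
  near: r; exact: riemannian_ball_mass_approx.
have approxT : `|fine (vol ([set: M] `&` riemannian_ball g x r)) -
    ball_mass (fwd phi @` ([set: M] `&` dom phi)) r| <= eta * (omega * r ^+ m).
  near: r; exact: riemannian_ball_mass_approx.
have massT : ball_mass (fwd phi @` ([set: M] `&` dom phi)) r = omega * r ^+ m.
  rewrite /ball_mass setTI setIidr; first by rewrite lebesgue_euclidean_ball.
  by rewrite euclidean_ball0E => y /= yr; apply: ball_image; exact: lt_trans rd.
rewrite massT setTI in approxT.
rewrite /density_ratio /euclidean_density_ratio lebesgue_euclidean_ball//=.
apply: le_trans (ratio_perturbation _ _ approxE approxT) _.
- by rewrite ball_mass_ge0 ball_mass_le.
- by rewrite (ltW eta0) ge_min lexx.
by rewrite mulrC -ler_pdivlMr ?ltr0n// ge_min lexx orbT.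
Unshelve. all: by end_near. Qed.
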